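(* Let $A$ generate a $C_0$-semigroup $(T(t))_{t\ge 0}$ on a Banach space $X$, let $U$ be a Banach space and $B\in\mathcal{L}(U,X)$. Then the following statements are equivalent (where in (i) and in (iv) the ''for some'' version and the ''for all'' version are both equivalent to the remaining statements). (i) The system $\Sigma(A,B)$ is $L^p$-ISS for some/all $p\in[1,\infty)$. (ii) The semigroup $(T(t))_{t\ge0}$ is exponentially stable. (iii) There exists $\lambda>0$ such that the function $$V(x):=\sup_{t\ge0}e^{\lambda t}\|T(t)x\|,\qquad x\in X,$$ is a coercive $L^1$-ISS Lyapunov function for $\Sigma(A,B)$. (iv) The system $\Sigma(A,B)$ is $L^p$-$L^q$-ISS for some/all $p,q\in[1,\infty)$ with $p\le q$.
   Context: For $B\in\mathcal{L}(U,X)$, $\Sigma(A,B)$ denotes the system $\dot x(t)=Ax(t)+Bu(t)$, $t\ge0$, $x(0)=x_0$. Put $\Phi_\tau u:=\int_0^\tau T(\tau-s)Bu(s)\,ds\in X$ for $\tau\ge 0$, $u\in L^p([0,\tau],U)$; the mild solution is $\phi(\tau,x_0,u)=T(\tau)x_0+\Phi_\tau u$. $(T(t))_{t\ge0}$ is exponentially stable if there are $M,\omega>0$ with $\|T(t)\|\le Me^{-\omega t}$ for all $t\ge0$. Comparison functions: $\mathcal{K}$ is the set of continuous strictly increasing $\gamma:[0,\infty)\to[0,\infty)$ with $\gamma(0)=0$; $\mathcal{K}_\infty$ the set of unbounded $\gamma\in\mathcal{K}$; $\mathcal{L}$ the set of continuous strictly decreasing $\gamma:[0,\infty)\to[0,\infty)$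 with $\lim_{t\to\infty}\gamma(t)=0$; $\mathcal{KL}$ the set of continuous $\beta:[0,\infty)^2\to[0,\infty)$ with $\beta(\cdot,t)\in\mathcal{K}$ for all $t\ge0$ and $\beta(r,\cdot)\in\mathcal{L}$ for all $r>0$. $\Sigma(A,B)$ is $L^p$-admissible if for some (equivalently, all) $\tau>0$, $u\in L^p([0,\tau],U)$ implies $\Phi_\tau u\in X$ (automatic here because $B\in\mathcal{L}(U,X)$). $\Sigma(A,B)$ is $L^p$-ISS if it is $L^p$-admissible and there are $\beta\in\mathcal{KL}$, $\gamma\in\mathcal{K}_\infty$ with $\|\phi(t,x,u)\|\le\beta(\|x\|,t)+\gamma(\|u\|_{L^p([0,t],U)})$ for all $t\ge0$, $x\in X$, $u\in L^p([0,t],U)$. $\Sigma(A,B)$ is $L^p$-$L^q$-admissible if for some (equivalently, all) $t>0$, $u\in L^p([0,t],U)$ implies $\Phi_{(\cdot)}u\in L^q([0,t],X)$. $\Sigma(A,B)$ is $L^p$-$L^q$-ISS if it is $L^p$-$L^q$-admissible and there are $\sigma,\gamma\in\mathcal{K}_\infty$ with $\|\phi(\cdot,x,u)\|_{L^q([0,t],X)}\le\sigma(\|x\|)+\gamma(\|u\|_{L^p([0,t],U)})$ for all $t\ge0$, $x\in X$, $u\in L^p([0,t],U)$. For real-valued $V$ on $X$, the Lie derivative at $x$ corresponding to the input $u$ is $\dot V_u(x):=\limsup_{t\downarrow0}\frac1t\big(V(\phi(t,x,u))-V(x)\big)$. A continuous function $V:X\to[0,\infty)$ is a coercive $L^1$-ISS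 Lyapunov function for $\Sigma(A,B)$ if there are $\psi_1,\psi_2\in\mathcal{K}_\infty$ and $a_3,a_4>0$ such that $\psi_1(\|x\|)\le V(x)\le\psi_2(\|x\|)$ for all $x\in X$ and $\dot V_u(x)\le-a_3V(x)+a_4\|u(0)\|_U$ for all $x\in X$ and all continuous $u:[0,\infty)\to U$. *)

(* Defs.v *)
From HB Require Import structures.
From mathcomp Require Import all_boot all_order all_algebra.
From mathcomp Require Import all_classical all_reals all_analysis.
Import Order.TTheory GRing.Theory Num.Theory.
Import numFieldNormedType.Exports.

Set Implicit Arguments.
Unset Strict Implicit.
Unset Printing Implicit Defensive.

Local Open Scope classical_set_scope.
Local Open Scope ring_scope.

(** Comparison functions. A function on [0, oo) is represented by a total
    function on R, of which only the values on [0, oo) matter. *)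
Section comparison_functions.
Context {R : realType}.

Definition class_K (g : R -> R) : Prop :=
  [/\ {within `[0, +oo[, continuous g},
      forall r, 0 <= r -> 0 <= g r,
      forall r s, 0 <= r -> r < s -> g r < g s
    & g 0 = 0].

Definition class_Kinf (g : R -> R) : Prop :=
  class_K g /\ forall M, exists2 r, 0 <= r & M < g r.

Definition class_L (g : R -> R) : Prop :=
  [/\ {within `[0, +oo[, continuous g},
      forall r, 0 <= r -> 0 <= g r,
      forall r s, 0 <= r -> r < s -> g s < g r
    & g r @[r --> +oo] --> 0].

Definition class_KL (b : R -> R -> R) : Prop :=
  [/\ {within (`[0, +oo[ `*` `[0, +oo[ : set (R * R)),
         continuous (fun z : R * R => b z.1 z.2)},
      forall t, 0 <= t -> class_K (b ^~ t)
    & forall r, 0 < r -> class_L (b r)].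

End comparison_functions.

(** Bochner integration and L^p over the interval [0, t]. *)
Section bochner.
Context {R : realType} {E : normedModType R}.
Local Notation mu := (@lebesgue_measure R).

Definition simple_fun (s : R -> E) : Prop :=
  finite_set (range s) /\
  forall y, measurable (s @^-1` [set y] : set (measurableTypeR R)).

Definition strongly_measurable (t : R) (f : R -> E) : Prop :=
  exists2 s : nat -> R -> E, (forall n, simple_fun (s n)) &
    {ae mu, forall r, `[0, t]%classic r -> s n r @[n --> \oo] --> f r}.

Definition simple_integral (t : R) (s : R -> E) : E :=
  \sum_(y \in range s) fine (mu (`[0, t] `&` s @^-1` [set y])) *: y.

(* Strong measurability is required because [\int] is a lower integral on
   functions that are not measurable. *)
Definition is_Bochner_integral (t : R) (f : R -> E) (z : E) : Prop :=
  strongly_measurable t f /\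
  exists s : nat -> R -> E,
    [/\ forall n, simple_fun (s n),
        (\int[mu]_(r in `[0%R, t]) `|f r - s n r|%:E)%E @[n --> \oo] --> 0%E
      & simple_integral t (s n) @[n --> \oo] --> z].

Definition Bochner_integrable (t : R) (f : R -> E) : Prop :=
  exists z, is_Bochner_integral t f z.

Definition Bochner_integral (t : R) (f : R -> E) : E :=
  xget 0 [set z | is_Bochner_integral t f z].

Definition eLp_norm (p t : R) (f : R -> E) : \bar R :=
  'N[mu]_p%:E[((fun r => `|f r|%:E) \_ `[0%R, t])%E]%E.

(* Elements of L^p([0, t], E) are handled through representatives. *)
Definition mem_Lp (p t : R) (f : R -> E) : Prop :=
  strongly_measurable t f /\ (eLp_norm p t f < +oo)%E.

Definition Lp_norm (p t : R) (f : R -> E) : R := fine (eLp_norm p t f).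

End bochner.

Section semigroups.
Context {R : realType} {X : completeNormedModType R}.
Implicit Types (T : R -> X -> X) (A : X -> X) (DA : set X).

(** [T] is a C_0-semigroup; only the values [T t] for [0 <= t] matter. *)
Definition C0_semigroup T : Prop :=
  [/\ forall t, 0 <= t -> linear (T t) /\ continuous (T t),
      forall x, T 0 x = x,
      forall s t x, 0 <= s -> 0 <= t -> T (s + t) x = T s (T t x)
    & forall x, T t x @[t --> 0^'+] --> x].

(** The operator [A] with domain [DA] is the generator of [T]; the values of
    [A] outside [DA] are irrelevant. *)
Definition generates A DA T : Prop :=
  DA = [set x | cvg (t^-1 *: (T t x - x) @[t --> 0^'+])] /\
  forall x, DA x -> t^-1 *: (T t x - x) @[t --> 0^'+] --> A x.

Definition operator_norm (F : X -> X) : R :=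
  sup [set `|F x| | x in [set x | `|x| <= 1]].

Definition exponentially_stable T : Prop :=
  exists M w : R, [/\ 0 < M, 0 < w &
    forall t, 0 <= t -> operator_norm (T t) <= M * expR (- w * t)].

End semigroups.

(** The system x' = A x + B u, x(0) = x_0, where [A] generates [T]. *)
Section systems.
Context {R : realType} {X U : completeNormedModType R}.
Variables (T : R -> X -> X) (B : U -> X).

Definition convolution_integrand (tau : R) (u : R -> U) (s : R) : X :=
  T (tau - s) (B (u s)).

Definition input_map (tau : R) (u : R -> U) : X :=
  Bochner_integral tau (convolution_integrand tau u).

Definition mild_solution (t : R) (x : X) (u : R -> U) : X :=
  T t x + input_map t u.

Definition Lp_admissible (p : R) : Prop :=
  exists2 tau : R, 0 < tau & forall u, mem_Lp p tau u ->
    Bochner_integrable tau (convolution_integrand tau u).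

Definition Lp_ISS (p : R) : Prop :=
  Lp_admissible p /\
  exists (b : R -> R -> R) (g : R -> R), [/\ class_KL b, class_Kinf g &
    forall t x u, 0 <= t -> mem_Lp p t u ->
      `|mild_solution t x u| <= b `|x| t + g (Lp_norm p t u)].

Definition Lp_Lq_admissible (p q : R) : Prop :=
  exists2 t : R, 0 < t & forall u, mem_Lp p t u ->
    (forall tau, 0 <= tau <= t ->
       Bochner_integrable tau (convolution_integrand tau u)) /\
    mem_Lp q t (input_map ^~ u).

Definition Lp_Lq_ISS (p q : R) : Prop :=
  Lp_Lq_admissible p q /\
  exists s g : R -> R, [/\ class_Kinf s, class_Kinf g &
    forall t x u, 0 <= t -> mem_Lp p t u ->
      (eLp_norm q t (fun r => mild_solution r x u) <=
       (s `|x| + g (Lp_norm p t u))%:E)%E].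

Definition Lie_derivative (V : X -> R) (u : R -> U) (x : X) : \bar R :=
  limf_esup (fun t : R => (t^-1 * (V (mild_solution t x u) - V x))%:E) 0^'+.

Definition coercive_L1_ISS_Lyapunov (V : X -> R) : Prop :=
  [/\ continuous V, forall x, 0 <= V x &
    exists (psi1 psi2 : R -> R) (a3 a4 : R),
      [/\ class_Kinf psi1 /\ class_Kinf psi2, 0 < a3 /\ 0 < a4,
          forall x, psi1 `|x| <= V x <= psi2 `|x| &
          forall (x : X) (u : R -> U), {within `[0, +oo[, continuous u} ->
            (Lie_derivative V u x <= (- a3 * V x + a4 * `|u 0%R|)%:E)%E]].

(** The function sup_(t >= 0) e^(l t) |T(t) x|, a priori extended real. *)
Definition sup_functional (l : R) (x : X) : \bar R :=
  ereal_sup [set (expR (l * t) * `|T t x|)%:E | t in `[0, +oo[].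

End systems.

(* Main.v *)
Require Import Defs.
From HB Require Import structures.
From mathcomp Require Import all_boot all_order all_algebra.
From mathcomp Require Import finmap ring lra.
From mathcomp Require Import all_classical all_reals all_analysis.
From mathcomp Require Import measurable_realfun.
Import Order.TTheory GRing.Theory Num.Theory.
Import numFieldNormedType.Exports.
Local Open Scope classical_set_scope.
Local Open Scope ring_scope.

(** Everything is compared with exponential stability. With zero input, L^p-ISS
    gives |T(t)x| <= beta(|x|, t), hence a time at which T is a contraction of
    ratio 1/2; L^p-L^q-ISS gives the uniform bound of Datko's theorem on the
    integrals of |T(.)x|^q; and the Lyapunov function V dominates
    e^(l t) |T(t)x|.

    Conversely, let |T(t)| <= M e^(-w t) and let y be the convolution of
    e^(-w .) with |u|^p. Then y <= |u|_p^p, the integral of y is at most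
    |u|_p^p / w by Tonelli, and v <= l + l^(1-p) v^p with l = y^(1/p) yields
    |Phi_t u| <= |B| M (1/w + 1) y(t)^(1/p). This gives both ISS estimates with
    linear gains. The Lyapunov function is V for the exponent w itself: it is an
    equivalent norm with V(T(t)x) <= e^(-w t) V(x).

    Phi u is strongly measurable because it is right-continuous; continuity
    from the left is never needed. *)

(** An element of L^p is given by a representative that is a limit of simple functions only almost
    everywhere, so its norm need not be Borel measurable, and on such functions the integral is
    merely a lower integral. Monotonicity survives this; additivity and Tonelli do not. Whenever the
    latter two are used, the representative is first replaced by an everywhere limit of simple
    functions that agrees with it almost everywhere. The constant 1/w + 1 arises as follows.
    Integrating v <= l + l^(1-p) v^p against e^(-w(t-s)) turns the first term into at most l/w and
    the second into l^(1-p) y(t). At l = y(t)^(1/p) the factor l^(1-p) y(t) equals l, so the sum is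
    at most (1/w + 1) l. The bound contains no t apart from y(t), which is why the gains are uniform
    in time. *)

Set Implicit Arguments.
Unset Strict Implicit.
Unset Printing Implicit Defensive.

(** * Monotonicity of the integral of nonnegative functions *)

Section ae_integral.
Context d (T : measurableType d) (R : realType) (mu : {measure set T -> \bar R}).
Import HBNNSimple.

(* No measurability is needed: on nonnegative functions the integral is a
   supremum over simple functions, which can be cut off on a null set. *)
Lemma ae_le_integral (D : set T) (f g : T -> \bar R) :
  (forall x, D x -> (0 <= f x)%E) -> (forall x, D x -> (0 <= g x)%E) ->
  {ae mu, forall x, D x -> (f x <= g x)%E} ->
  (\int[mu]_(x in D) f x <= \int[mu]_(x in D) g x)%E.
Proof.
move=> f0 g0 [N [mN N0 fgN]].
rewrite (integral_mkcond D f) (integral_mkcond D g).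
rewrite !ge0_integralTE; [|exact: erestrict_ge0|exact: erestrict_ge0].
apply: ge_ereal_sup => _ [h /= hf <-].
pose h' := mul_nnsfun h (indic_nnsfun R (measurableC mN)).
have h'E x : h' x = h x * \1_(~` N) x by [].
have -> : sintegral mu h = sintegral mu h'.
  rewrite -!integralT_nnsfun; apply: ae_eq_integral => //.
  - exact/measurable_EFinP.
  - exact/measurable_EFinP.
  - exists N; split => // x /=; apply: contra_notP => xN _.
    by rewrite mindicE mem_set ?mulr1.
apply: ereal_sup_ubound; exists h' => // x; rewrite h'E indicE.
have [xN|xN] := boolP (x \in ~` N); last first.
  by rewrite mulr0; exact: erestrict_ge0.
rewrite mulr1; have := hf x; rewrite !patchE.
case: ifPn => // xD /le_trans; apply.
move: xN; rewrite inE; apply: contra_notP => fg; apply: fgN => /= /(_ _).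
by move=> /(_ (set_mem xD)).
Qed.

Lemma ge0_le_integralW (D : set T) (f g : T -> \bar R) :
  (forall x, D x -> (0 <= f x)%E) -> (forall x, D x -> (f x <= g x)%E) ->
  (\int[mu]_(x in D) f x <= \int[mu]_(x in D) g x)%E.
Proof.
move=> f0 fg; apply: ae_le_integral => //.
  by move=> x Dx; exact: le_trans (f0 x Dx) (fg x Dx).
exact: aeW.
Qed.

Lemma ge0_ae_eq_integralW (D : set T) (f g : T -> \bar R) :
  (forall x, D x -> (0 <= f x)%E) -> (forall x, D x -> (0 <= g x)%E) ->
  {ae mu, forall x, D x -> f x = g x} ->
  (\int[mu]_(x in D) f x = \int[mu]_(x in D) g x)%E.
Proof.
move=> f0 g0 fg; apply/eqP; rewrite eq_le; apply/andP; split;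
  apply: ae_le_integral => //; apply: filterS fg => x fg Dx;
  by rewrite fg.
Qed.

End ae_integral.

(** * Simple functions *)

Section finitely_valued.
Context d (T : measurableType d).

(* The values range over an arbitrary type, so that two simple functions can be
   handled jointly through their pairing. *)
Definition finitely_valued (I : Type) (a : T -> I) : Prop :=
  finite_set (range a) /\ forall i, measurable (a @^-1` [set i]).

(** Only the finitely many values of [a] lying in [S] count, so [S] can be any set. This is why
    simple functions can be composed with arbitrary maps below. *)
Lemma finitely_valued_preimage (I : Type) (a : T -> I) (S : set I) :
  finitely_valued a -> measurable (a @^-1` S).
Proof.
move=> [fa ma].
have -> : a @^-1` S = \bigcup_(i in range a `&` S) (a @^-1` [set i]).
  apply/seteqP; split => [x Sax|x [i [_ Si] /= ->//]].
  by exists (a x) => //; split => //; exists x.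
by apply: fin_bigcup_measurable => //; apply: sub_finite_set fa; exact: subIsetl.
Qed.

Lemma finitely_valued_comp (I J : Type) (a : T -> I) (h : I -> J) :
  finitely_valued a -> finitely_valued (h \o a).
Proof.
move=> fa; split; last first.
  by move=> j; rewrite comp_preimage; exact: finitely_valued_preimage.
by rewrite -(image_comp a h); exact: (finite_image h fa.1).
Qed.

Lemma finitely_valued_pair (I J : Type) (a : T -> I) (b : T -> J) :
  finitely_valued a -> finitely_valued b ->
  finitely_valued (fun x => (a x, b x)).
Proof.
move=> [fa ma] [fb mb]; split.
  apply: (@sub_finite_set _ _ (range a `*` range b)); last exact: finite_setX.
  by move=> _ [x _ <-]; split; exists x.
move=> [i j].
have -> : (fun x => (a x, b x)) @^-1` [set (i, j)] =
    a @^-1` [set i] `&` b @^-1` [set j].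
  by apply/seteqP; split => x /= => [[-> ->]|[-> ->]].
exact: measurableI.
Qed.

Lemma finitely_valued_indic (D : set T) : measurable D ->
  finitely_valued (fun x => x \in D).
Proof.
move=> mD; split; first exact: finite_finset.
case.
  suff -> : (fun x => x \in D) @^-1` [set true] = D by [].
  by apply/seteqP; split => x /=; [move/set_mem|move/mem_set].
suff -> : (fun x => x \in D) @^-1` [set false] = ~` D by exact: measurableC.
apply/seteqP; split => x /=; first by move=> /negbT; rewrite notin_setE.
by move=> xD; apply/negbTE; rewrite notin_setE.
Qed.

Lemma sum_finitely_valued (I : choiceType) (V : nmodType) (a : T -> I)
    (h : I -> V) x : finitely_valued a ->
  h (a x) = \sum_(i <- fset_set (range a)) (if i == a x then h i else 0).
Proof.
move=> [fa _]; rewrite (bigD1_seq (a x)) ?fset_uniq//=; last first.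
  by rewrite in_fset_set// inE; exists x.
by rewrite eqxx big1 ?addr0// => i /negbTE ->.
Qed.

End finitely_valued.

Section simple_integrals.
Context d (T : measurableType d) (R : realType) (mu : {measure set T -> \bar R}).
Variable D : set T.
Hypotheses (mD : measurable D) (finD : (mu D < +oo)%E).

Lemma measurable_finitely_valued (I : Type) (a : T -> I) (h : I -> R) :
  finitely_valued a -> measurable_fun setT (h \o a).
Proof.
by move=> fa _ B mB; rewrite setTI comp_preimage; exact: finitely_valued_preimage.
Qed.

Lemma fin_num_measureI (S : set T) : measurable S -> mu (D `&` S) \is a fin_num.
Proof.
move=> mS; rewrite ge0_fin_numE//; apply: le_lt_trans finD.
by apply: le_measure; rewrite ?inE//; exact: measurableI.
Qed.

Lemma integral_finitely_valued (I : choiceType) (a : T -> I) (h : I -> R) :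
  finitely_valued a -> (forall i, 0 <= h i) ->
  (\int[mu]_(x in D) (h (a x))%:E)%E =
  (\sum_(i <- fset_set (range a)) fine (mu (D `&` a @^-1` [set i])) * h i)%:E.
Proof.
move=> fa h0.
transitivity (\int[mu]_(x in D) (\sum_(i <- fset_set (range a))
    (h i)%:E * (\1_(a @^-1` [set i]) x)%:E))%E.
  apply: eq_integral => x _; rewrite (sum_finitely_valued _ _ fa) -sumEFin.
  apply: eq_bigr => i _; rewrite indicE; case: eqVneq => [->|aix].
    by rewrite mem_set// mule1.
  by rewrite memNset ?mule0// => /esym/eqP; apply/negP.
have mi i : measurable_fun D (EFin \o \1_(a @^-1` [set i]) : T -> \bar R).
  by apply/measurable_EFinP; apply: measurable_indic; case: fa.
rewrite ge0_integral_sum//; last 2 first.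
- by move=> i; apply: measurable_funeM; exact: mi.
- by move=> i x _; rewrite mule_ge0// lee_fin.
rewrite -sumEFin; apply: eq_bigr => i _.
have mai := fa.2 i.
rewrite (ge0_integralZl_EFin mu mD _ (mi i) (h0 i)); last by move=> x _; rewrite lee_fin.
rewrite integral_indic//.
by rewrite muleC EFinM setIC fineK//; exact: fin_num_measureI.
Qed.

(** A simple integral can be computed on any finer partition, because each level set of [h \o a] is
    a disjoint union of level sets of [a]. Two simple functions can thus be integrated over the
    level sets of their pairing. *)
Lemma sum_finitely_valued_comp (I J : choiceType) (E : lmodType R) (a : T -> I)
    (h : I -> J) (e : J -> E) : finitely_valued a ->
  \sum_(j <- fset_set (range (h \o a)))
    fine (mu (D `&` (h \o a) @^-1` [set j])) *: e j =
  \sum_(i <- fset_set (range a)) fine (mu (D `&` a @^-1` [set i])) *: e (h i).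
Proof.
move=> fa; have fha := finitely_valued_comp h fa.
(* The measure of each level set of [h \o a] is distributed over the level sets of [a]; the factor
   [(j == h i)%:R] selects those contained in it. *)
transitivity (\sum_(j <- fset_set (range (h \o a)))
  \sum_(i <- fset_set (range a)) (fine (mu (D `&` a @^-1` [set i])) *
    (j == h i)%:R) *: e j).
  apply: eq_bigr => j _; rewrite -scaler_suml; congr (_ *: _).
  have mj := fha.2 j; rewrite setIC -integral_indic//.
  transitivity (fine (\int[mu]_(x in D) ((j == h (a x))%:R)%:E)%E).
    congr fine; apply: eq_integral => x _; rewrite indicE; congr (_%:R)%:E.
    case: eqVneq => [->|jx]; first by rewrite mem_set.
    by rewrite memNset//= => /esym/eqP; apply/negP.
  by rewrite (@integral_finitely_valued _ _ (fun i => (j == h i)%:R)).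
rewrite exchange_big/=; apply: eq_big_seq => i.
rewrite in_fset_set; last by case: fa.
move=> /set_mem[x _ <-].
rewrite (bigD1_seq (h (a x))) ?fset_uniq//=; last first.
  by rewrite in_fset_set ?inE; [exists x|case: fha].
rewrite eqxx mulr1 big1 ?addr0// => j /negbTE ->.
by rewrite mulr0 scale0r.
Qed.

End simple_integrals.

Section simple_integral_theory.
Context (R : realType).
Local Notation mu := (@lebesgue_measure R).
Local Notation MR := (measurableTypeR R).
Implicit Types t : R.

Lemma fin_itv t : (mu `[0%R, t]%classic < +oo)%E.
Proof. by rewrite lebesgue_measure_itv /=; case: ifP => // _; rewrite -EFinB ltry. Qed.

Lemma measurable_itv0 t : measurable (`[0, t]%classic : set MR).
Proof. exact: measurable_itv. Qed.
Hint Resolve fin_itv measurable_itv0 : core.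

Lemma simple_integral_comp (I : choiceType) (E : normedModType R) t
    (a : MR -> I) (h : I -> E) : finitely_valued a ->
  simple_integral t (h \o a) =
  \sum_(i <- fset_set (range a)) fine (mu (`[0, t] `&` a @^-1` [set i])) *: h i.
Proof.
move=> fa; rewrite /simple_integral fsbig_finite; last first.
  exact: (finitely_valued_comp h fa).1.
exact: (@sum_finitely_valued_comp _ _ _ mu _ (measurable_itv0 t) (fin_itv t)
  I E E a h id fa).
Qed.

Lemma simple_integralB (E : normedModType R) t (s1 s2 : R -> E) :
  simple_fun s1 -> simple_fun s2 ->
  simple_integral t s1 - simple_integral t s2 = simple_integral t (s1 \- s2).
Proof.
move=> fs1 fs2; pose a r := (s1 r, s2 r).
have fa : finitely_valued (a : MR -> _) by exact: finitely_valued_pair.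
rewrite (@simple_integral_comp _ _ t a fst)//.
rewrite (@simple_integral_comp _ _ t a snd)//.
rewrite (@simple_integral_comp _ _ t a (fun z => z.1 - z.2))//.
by rewrite -sumrB; apply: eq_bigr => i _; rewrite scalerBr.
Qed.

Lemma simple_integral_linear (E F : normedModType R) t (L : {linear E -> F})
    (s : R -> E) : simple_fun s ->
  L (simple_integral t s) = simple_integral t (L \o s).
Proof.
move=> fs; rewrite (@simple_integral_comp _ _ t s id)//.
rewrite (@simple_integral_comp _ _ t s L)// linear_sum.
by apply: eq_bigr => i _; rewrite linearZ.
Qed.

Lemma norm_simple_integral_le (E : normedModType R) t (s : R -> E) :
  simple_fun s ->
  (`|simple_integral t s|%:E <= \int[mu]_(r in `[0%R, t]) `|s r|%:E)%E.
Proof.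
move=> fs; rewrite (@simple_integral_comp _ _ t s id)//.
rewrite (@integral_finitely_valued _ _ _ mu _ (measurable_itv0 t) (fin_itv t)
  E s (fun y => `|y|))//.
rewrite lee_fin; apply: le_trans (ler_norm_sum _ _ _) _.
apply: ler_sum => i _; rewrite normrZ ler_wpM2r// ger0_norm//.
by apply: fine_ge0.
Qed.

(** Extension by zero makes integrals over intervals of different lengths comparable: both become
    integrals over the longer one. *)
Definition cutoff (E : normedModType R) t (f : R -> E) : R -> E :=
  fun r => if r \in `[0, t]%classic then f r else 0.

Lemma simple_fun_cutoff (E : normedModType R) t (s : R -> E) :
  simple_fun s -> simple_fun (cutoff t s).
Proof.
move=> fs; have := finitely_valued_pair fs (finitely_valued_indic (@measurable_itv0 t)).
exact: (finitely_valued_comp (fun z : E * bool => if z.2 then z.1 else 0)).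
Qed.

Lemma simple_integral_cutoff (E : normedModType R) t t' (s : R -> E) :
  simple_fun s -> t <= t' ->
  simple_integral t' (cutoff t s) = simple_integral t s.
Proof.
move=> fs tt'; pose a r := (s r, r \in `[0, t]%classic).
have fa : finitely_valued (a : MR -> _).
  exact: (finitely_valued_pair fs (finitely_valued_indic (@measurable_itv0 t))).
rewrite [LHS](@simple_integral_comp _ _ t' a (fun z => if z.2 then z.1 else 0))//.
rewrite [RHS](@simple_integral_comp _ _ t a fst)//.
apply: eq_bigr => -[y []] _ /=.
  congr (fine (mu _) *: _); apply/seteqP; split => r /= [r0t [sry rt]].
    by split; [exact: set_mem rt|rewrite /a sry rt].
  split; last by rewrite /a sry rt.
  by move: r0t; rewrite !in_itv/= => /andP[-> /le_trans]; exact.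
rewrite scaler0 (_ : _ `&` _ = set0) ?measure0 ?scale0r//.
by apply/seteqP; split => // r /= [r0t [_]]; rewrite mem_set.
Qed.

Lemma simple_fun2 (E F G : normedModType R) (h : E -> F -> G)
    (s1 : R -> E) (s2 : R -> F) : simple_fun s1 -> simple_fun s2 ->
  simple_fun (fun r => h (s1 r) (s2 r)).
Proof.
move=> fs1 fs2.
exact: (finitely_valued_comp (fun z => h z.1 z.2) (finitely_valued_pair fs1 fs2)).
Qed.

Lemma simple_fun_cst (E : normedModType R) (x : E) : simple_fun (fun _ : R => x).
Proof.
split; first exact: finite_image_cst.
move=> y; have [->|yx] := eqVneq y x.
  by rewrite (_ : _ @^-1` _ = setT)//; apply/seteqP; split.
rewrite (_ : _ @^-1` _ = set0)//; apply/seteqP; split => // r /= xy.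
by rewrite xy eqxx in yx.
Qed.

End simple_integral_theory.
#[local] Hint Resolve fin_itv measurable_itv0 : core.

(** * The Bochner integral *)

#[local] Instance ae_lebesgue_filter (R : realType) :
  Filter (nbhs (almost_everywhere (@lebesgue_measure R))).
Proof. exact: (ae_filter_ringOfSetsType (@lebesgue_measure R)). Qed.

Section bochner_theory.
Context (R : realType).
Local Notation mu := (@lebesgue_measure R).
Local Notation MR := (measurableTypeR R).
Implicit Types t : R.

(* Limits are taken everywhere and not only almost everywhere, so that norms of
   such functions are Borel measurable. *)
Definition simple_limit (E : normedModType R) (f : R -> E) : Prop :=
  exists2 s : nat -> R -> E, (forall n, simple_fun (s n)) &
    forall r, s n r @[n --> \oo] --> f r.

Lemma simple_limit_simple (E : normedModType R) (s : R -> E) :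
  simple_fun s -> simple_limit s.
Proof. by move=> fs; exists (fun=> s) => // r; exact: cvg_cst. Qed.

Lemma simple_limitB (E : normedModType R) (f g : R -> E) :
  simple_limit f -> simple_limit g -> simple_limit (f \- g).
Proof.
move=> [s fs sf] [u fu ug]; exists (fun n => s n \- u n).
  by move=> n; exact: (@simple_fun2 _ _ _ _ (fun x y => x - y)).
by move=> r; apply: cvgB.
Qed.

Lemma simple_limit_measurable_norm (E : normedModType R) (f : R -> E) :
  simple_limit f -> measurable_fun (setT : set MR) (fun r => `|f r|).
Proof.
move=> [s fs sf]; apply: (@measurable_fun_cvg _ _ _ _ (fun n r => `|s n r|)).
  move=> n; apply: (@measurable_finitely_valued _ MR _ _ (s n : MR -> E) (fun y => `|y|)).
  exact: fs.
by move=> r _; apply: cvg_norm; exact: sf.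
Qed.

Lemma simple_limit_emeasurable (E : normedModType R) (D : set MR) (f : R -> E) :
  simple_limit f -> measurable_fun D (fun r => `|f r|%:E).
Proof.
move=> /simple_limit_measurable_norm mf.
by apply/measurable_EFinP; exact: measurable_funTS.
Qed.

(** Setting the function and its approximations to 0 on the exceptional null set and outside [0, t]
    turns almost everywhere convergence into convergence everywhere. *)
Lemma strongly_measurableP (E : normedModType R) t (f : R -> E) :
  strongly_measurable t f <->
  exists2 f', simple_limit f' & {ae mu, forall r, `[0, t]%classic r -> f r = f' r}.
Proof.
split=> [[s fs [N [mN N0 sfN]]]|[f' [s fs sf'] ff']].
  have mD : measurable (`[0, t]%classic `\` N : set MR) by exact: measurableD.
  exists (fun r => if r \in `[0, t]%classic `\` N then f r else 0); last first.
    exists N; split => // r /=; apply: contra_notP => rN rt.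
    by rewrite mem_set.
  exists (fun n r => if r \in `[0, t]%classic `\` N then s n r else 0).
    move=> n; have := finitely_valued_pair (fs n) (finitely_valued_indic mD).
    exact: (finitely_valued_comp (fun z : E * bool => if z.2 then z.1 else 0)).
  move=> r; case: ifPn => [/set_mem[rt rN]|_]; last exact: cvg_cst.
  by move: rN; apply: contra_notP => srf; apply: sfN => /= /(_ rt).
exists s => //; apply: filterS ff' => r ff' rt.
by rewrite ff'//; exact: sf'.
Qed.

Lemma strongly_measurable_simple_limit (E : normedModType R) t (f : R -> E) :
  simple_limit f -> strongly_measurable t f.
Proof. by move=> lf; apply/strongly_measurableP; exists f => //; exact: aeW. Qed.

Lemma eq_strongly_measurable (E : normedModType R) t (f g : R -> E) :
  {ae mu, forall r, `[0, t]%classic r -> f r = g r} ->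
  strongly_measurable t f -> strongly_measurable t g.
Proof.
move=> fg [s fs sf]; exists s => //.
by apply: filterS2 fg sf => r fg sf rt; rewrite -fg//; exact: sf.
Qed.

Lemma strongly_measurableB (E : normedModType R) t (f g : R -> E) :
  strongly_measurable t f -> strongly_measurable t g ->
  strongly_measurable t (f \- g).
Proof.
move=> /strongly_measurableP[f' lf' ff'] /strongly_measurableP[g' lg' gg'].
apply/strongly_measurableP; exists (f' \- g'); first exact: simple_limitB.
by apply: filterS2 ff' gg' => r ff' gg' rt /=; rewrite ff'// gg'.
Qed.

Lemma strongly_measurable_comp (E F : normedModType R) t (h : E -> F)
    (f : R -> E) : continuous h ->
  strongly_measurable t f -> strongly_measurable t (h \o f).
Proof.
move=> ch [s fs sf]; exists (fun n => h \o s n).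
  by move=> n; exact: (finitely_valued_comp h (fs n)).
by apply: filterS sf => r sf rt; apply: continuous_cvg; [exact: ch|exact: sf].
Qed.

Lemma strongly_measurable_cutoff (E : normedModType R) t t' (f : R -> E) :
  strongly_measurable t f -> strongly_measurable t' (cutoff t f).
Proof.
move=> [s fs sf]; exists (fun n => cutoff t (s n)).
  by move=> n; exact: simple_fun_cutoff.
apply: filterS sf => r sf _; rewrite /cutoff.
by case: ifPn => [/set_mem/sf//|_]; exact: cvg_cst.
Qed.

Lemma strongly_measurableS (E : normedModType R) t t' (f : R -> E) :
  t' <= t -> strongly_measurable t f -> strongly_measurable t' f.
Proof.
move=> tt' [s fs sf]; exists s => //; apply: filterS sf => r sf /=.
rewrite in_itv/= => /andP[r0 rt']; apply: sf.
by rewrite /= in_itv/= r0 (le_trans rt').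
Qed.

Lemma eq_integral_norm (E : normedModType R) (D : set R) (f f' : R -> E) :
  {ae mu, forall r, D r -> f r = f' r} ->
  (\int[mu]_(r in D) `|f r|%:E = \int[mu]_(r in D) `|f' r|%:E)%E.
Proof.
move=> ff'; apply: ge0_ae_eq_integralW => [r _|r _|]; [by rewrite lee_fin..|].
by apply: filterS ff' => r ff' rt; rewrite ff'.
Qed.

(** The triangle inequality needs additivity of the integral, hence measurable norms: all three
    integrals are moved to representatives before they are compared. *)
Lemma integral_normB (E : normedModType R) t (f g : R -> E) :
  strongly_measurable t f -> strongly_measurable t g ->
  (\int[mu]_(r in `[0%R, t]) `|f r - g r|%:E <=
   \int[mu]_(r in `[0%R, t]) `|f r|%:E + \int[mu]_(r in `[0%R, t]) `|g r|%:E)%E.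
Proof.
move=> /strongly_measurableP[f' lf' ff'] /strongly_measurableP[g' lg' gg'].
rewrite (eq_integral_norm ff') (eq_integral_norm gg').
rewrite (@eq_integral_norm _ _ (f \- g) (f' \- g')); last first.
  by apply: filterS2 ff' gg' => r ff' gg' rt /=; rewrite ff'// gg'.
rewrite -ge0_integralD//; try exact: simple_limit_emeasurable.
by apply: ge0_le_integralW => r _; rewrite lee_fin//; exact: ler_normB.
Qed.

Lemma integral_normZ (E : normedModType R) t (C : R) (f : R -> E) : 0 <= C ->
  strongly_measurable t f ->
  (\int[mu]_(r in `[0%R, t]) (C * `|f r|)%:E =
   C%:E * \int[mu]_(r in `[0%R, t]) `|f r|%:E)%E.
Proof.
move=> C0 /strongly_measurableP[f' lf' ff'].
rewrite (eq_integral_norm ff') -ge0_integralZl_EFin//; last first.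
  exact: simple_limit_emeasurable.
apply: ge0_ae_eq_integralW => [r _|r _|]; [by rewrite lee_fin mulr_ge0..|].
by apply: filterS ff' => r ff' rt; rewrite ff'.
Qed.

Lemma norm_Bochner_integral_le (E : normedModType R) t (f : R -> E) z :
  is_Bochner_integral t f z ->
  (`|z|%:E <= \int[mu]_(r in `[0%R, t]) `|f r|%:E)%E.
Proof.
move=> [mf [s [fs sf Iz]]].
have cz : `|simple_integral t (s n)|%:E @[n --> \oo] --> `|z|%:E.
  by apply: cvg_EFin; [exact: nearW|exact: cvg_norm].
have cf : (\int[mu]_(r in `[0%R, t]) `|f r|%:E +
    \int[mu]_(r in `[0%R, t]) `|f r - s n r|%:E)%E @[n --> \oo] -->
    (\int[mu]_(r in `[0%R, t]) `|f r|%:E + 0)%E.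
  apply: cvgeD => //; last exact: cvg_cst.
  by rewrite ge0_adde_def ?inE ?integral_ge0// => *; rewrite lee_fin.
rewrite -[leRHS]adde0; apply: lee_cvg_to cz cf _; apply: nearW => n.
apply: le_trans (norm_simple_integral_le _ (fs n)) _.
have mfs : strongly_measurable t (f \- s n).
  apply: strongly_measurableB => //.
  exact/strongly_measurable_simple_limit/simple_limit_simple.
apply: le_trans (integral_normB mf mfs).
by apply: ge0_le_integralW => r _; rewrite lee_fin//= opprB addrC subrK.
Qed.

Lemma is_Bochner_integralB (E : normedModType R) t (f g : R -> E) z w :
  is_Bochner_integral t f z -> is_Bochner_integral t g w ->
  is_Bochner_integral t (f \- g) (z - w).
Proof.
move=> [mf [s [fs sf Iz]]] [mg [u [fu ug Iw]]].
split; first exact: strongly_measurableB.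
have msimple v : simple_fun v -> strongly_measurable t (v : R -> E).
  by move=> ?; exact/strongly_measurable_simple_limit/simple_limit_simple.
exists (fun n => s n \- u n); split.
- by move=> n; exact: (@simple_fun2 _ _ _ _ (fun x y => x - y)).
- apply: (@squeeze_cvge _ _ _ _ (cst 0%E) _ (fun n =>
    \int[mu]_(r in `[0%R, t]) `|f r - s n r|%:E +
    \int[mu]_(r in `[0%R, t]) `|g r - u n r|%:E)%E); first last.
  + by rewrite -[X in _ --> X]adde0; apply: cvgeD.
  + exact: cvg_cst.
  apply: nearW => n; rewrite integral_ge0/=; last by move=> r _; rewrite lee_fin.
  apply: le_trans (integral_normB (strongly_measurableB mf (msimple _ (fs n)))
    (strongly_measurableB mg (msimple _ (fu n)))).
  apply: ge0_le_integralW => r _; rewrite lee_fin//=.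
  by rewrite !opprD !opprK addrACA.
- rewrite (_ : (fun _ => _) =
    (fun n => simple_integral t (s n) - simple_integral t (u n))).
    exact: cvgB.
  by apply/funext => n; rewrite simple_integralB.
Qed.

Lemma linear_is_Bochner_integral (E F : normedModType R) t
    (L : {linear E -> F}) (C : R) (f : R -> E) z :
  (forall y, `|L y| <= C * `|y|) -> continuous L ->
  is_Bochner_integral t f z -> is_Bochner_integral t (L \o f) (L z).
Proof.
move=> LC cL [mf [s [fs sf Iz]]]; split; first exact: strongly_measurable_comp.
exists (fun n => L \o s n); split.
- by move=> n; exact: (finitely_valued_comp L (fs n)).
- apply: (@squeeze_cvge _ _ _ _ (cst 0%E) _ (fun n =>
    `|C|%:E * \int[mu]_(r in `[0%R, t]) `|f r - s n r|%:E)%E); first last.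
  + by rewrite -[X in _ --> X](mule0 `|C|%:E); apply: cvgeZl.
  + exact: cvg_cst.
  apply: nearW => n; rewrite integral_ge0/=; last by move=> r _; rewrite lee_fin.
  rewrite -(@integral_normZ _ _ _ (f \- s n))//; last first.
    apply: strongly_measurableB => //.
    exact/strongly_measurable_simple_limit/simple_limit_simple.
  apply: ge0_le_integralW => r _; rewrite lee_fin//= -linearB.
  by apply: le_trans (LC _) _; apply: ler_wpM2r => //; exact: ler_norm.
- rewrite (_ : (fun _ => _) = (fun n => L (simple_integral t (s n)))).
    by apply: continuous_cvg => //; exact: cL.
  by apply/funext => n; rewrite simple_integral_linear.
Qed.

Lemma integral_cutoff (E : normedModType R) t t' (f : R -> E) : t <= t' ->
  (\int[mu]_(r in `[0%R, t']) `|cutoff t f r|%:E =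
   \int[mu]_(r in `[0%R, t]) `|f r|%:E)%E.
Proof.
move=> tt'; rewrite integral_mkcond [RHS]integral_mkcond.
congr (integral mu _ _); apply/funext => r; rewrite !patchE /cutoff.
case: (boolP (r \in `[0, t]%classic)) => [|_]; last first.
  by case: ifP => //; rewrite normr0.
move=> /set_mem; rewrite /= in_itv/= => /andP[r0 rt].
by rewrite mem_set//= in_itv/= r0 (le_trans rt tt').
Qed.

Lemma is_Bochner_integral_cutoff (E : normedModType R) t t' (f : R -> E) z :
  t <= t' -> is_Bochner_integral t f z -> is_Bochner_integral t' (cutoff t f) z.
Proof.
move=> tt' [mf [s [fs sf Iz]]]; split; first exact: strongly_measurable_cutoff mf.
exists (fun n => cutoff t (s n)); split.
- by move=> n; exact: simple_fun_cutoff.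
- rewrite (_ : (fun _ => _) =
    (fun n => \int[mu]_(r in `[0%R, t]) `|f r - s n r|%:E)%E)//.
  apply/funext => n; rewrite -(@integral_cutoff _ t t' (f \- s n))//; apply: eq_integral => r _.
  by rewrite /cutoff /=; case: ifP => // _; rewrite subr0.
- by rewrite (_ : (fun _ => _) = (fun n => simple_integral t (s n)))//;
    apply/funext => n; rewrite simple_integral_cutoff.
Qed.

End bochner_theory.

Lemma cvge0_near_lt (R : realType) (F : nat -> \bar R) (e : R) : 0 < e ->
  F n @[n --> \oo] --> 0%E -> \forall n \near \oo, (F n < e%:E)%E.
Proof.
move=> e0 /fine_cvgP[Ffin /cvgr0Pnorm_lt/(_ e e0)].
apply: filterS2 Ffin => n Ffin Fe.
by rewrite -(fineK Ffin) lte_fin; apply: le_lt_trans Fe; exact: ler_norm.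
Qed.

Section bochner_existence.
Context (R : realType) (E : completeNormedModType R).
Local Notation mu := (@lebesgue_measure R).
Local Notation MR := (measurableTypeR R).

(** Bochner's criterion. Completeness of [E] provides the limit of the simple integrals. *)
Lemma integrable_Bochner (t : R) (f : R -> E) : strongly_measurable t f ->
  (\int[mu]_(r in `[0%R, t]) `|f r|%:E < +oo)%E -> Bochner_integrable t f.
Proof.
move=> mf; have /strongly_measurableP[f' lf' ff'] := mf.
rewrite (eq_integral_norm ff') => intf.
have [s fs sf] := lf'.
have mnf := simple_limit_measurable_norm lf'.
have mns n := simple_limit_measurable_norm (simple_limit_simple (fs n)).
(* Truncating at [`|f'| + 1] makes dominated convergence applicable and keeps
   the approximating functions simple. *)
pose A n : set MR := [set r | `|s n r| <= `|f' r| + 1].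
have mA n : measurable (A n).
  rewrite -[A n]setTI; apply: (measurable_fun_le _ (mns n)) => //.
  exact: measurable_funD.
pose s' n r := if r \in A n then s n r else 0.
have fs' n : simple_fun (s' n).
  have := finitely_valued_pair (fs n) (finitely_valued_indic (mA n)).
  exact: (finitely_valued_comp (fun z : E * bool => if z.2 then z.1 else 0)).
have ls' n := simple_limit_simple (fs' n).
have s'_le n r : `|s' n r| <= `|f' r| + 1.
  rewrite /s'; case: ifPn => [/set_mem//|_].
  by rewrite normr0 addr_ge0.
have s'f r : s' n r @[n --> \oo] --> f' r.
  apply: cvg_trans (sf r); apply: near_eq_cvg.
  have lt1 : `|f' r| < `|f' r| + 1 by rewrite ltrDl ltr01.
  apply: filterS (cvgr_le _ (cvg_norm (sf r)) _ lt1) => n snr.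
  by rewrite /s' mem_set.
have cvg0 : (\int[mu]_(r in `[0%R, t]) `|f' r - s' n r|%:E)%E @[n --> \oo] --> 0%E.
  (* The dominating function comes from |f' - s'| <= |f'| + (|f'| + 1); its constant part is
     integrable because the interval is bounded. *)
  have [|||||_ _] := @dominated_convergence _ _ _ mu `[0, t]%classic
    (measurable_itv0 t) (fun n r => `|f' r - s' n r|%:E) (cst 0%E)
    (fun r => (2 * `|f' r| + 1)%:E).
  - move=> n; apply: (@simple_limit_emeasurable _ _ _ (f' \- s' n)).
    exact: simple_limitB.
  - exact: measurable_cst.
  - apply: aeW => r _; apply: cvg_EFin; first exact: nearW.
    rewrite -[X in _ --> X](@normr0 _ E) -[X in `|X|](subrr (f' r)).
    by apply: cvg_norm; apply: cvgB => //; exact: cvg_cst.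
  - apply/integrableP; split.
      apply/measurable_EFinP; apply: measurable_funD => //.
      by apply: measurable_funM => //; exact: measurable_funTS.
    under eq_integral do rewrite gee0_abs ?lee_fin ?addr_ge0 ?mulr_ge0// EFinD EFinM.
    rewrite ge0_integralD//; last first.
      by apply: measurable_funeM; exact: simple_limit_emeasurable.
    rewrite ge0_integralZl_EFin//; last exact: simple_limit_emeasurable.
    rewrite integral_cst// mul1e; apply: lte_add_pinfty; last exact: fin_itv.
    by rewrite lte_mul_pinfty// lee_fin.
  - apply: aeW => r n _; rewrite gee0_abs ?lee_fin//.
    by apply: le_trans (ler_normB _ _) _; have := s'_le n r; lra.
  - by rewrite integral0.
(* The simple integrals are Cauchy, since their distance is controlled by the L^1 distances to
   [f']. *)
have Jle n m : (`|simple_integral t (s' n) - simple_integral t (s' m)|%:E <=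
    \int[mu]_(r in `[0%R, t]) `|f' r - s' n r|%:E +
    \int[mu]_(r in `[0%R, t]) `|f' r - s' m r|%:E)%E.
  have msm k : strongly_measurable t (f' \- s' k).
    by apply/strongly_measurable_simple_limit/simple_limitB.
  rewrite distrC simple_integralB//; apply: le_trans (integral_normB (msm n) (msm m)).
  apply: le_trans (norm_simple_integral_le _ _) _.
    exact: (@simple_fun2 _ _ _ _ (fun x y => x - y)).
  apply: ge0_le_integralW => r _; rewrite lee_fin//=.
  by rewrite opprB [X in _ <= `|X|]addrC addrA subrK.
have cJ : cvg (simple_integral t (s' n) @[n --> \oo]).
  apply/cauchy_cvgP/cauchy_exP => e e0.
  have e20 : 0 < e / 2 by rewrite divr_gt0.
  have [N _ HN] := cvge0_near_lt e20 cvg0.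
  exists (simple_integral t (s' N)); exists N => // n /= Nn.
  rewrite -ball_normE /ball_/= -lte_fin; apply: le_lt_trans (Jle _ _) _.
  by rewrite [e in e%:E]splitr EFinD; apply: lteD; apply: HN => /=.
exists (lim (simple_integral t (s' n) @[n --> \oo])); split => //.
exists s'; split => //.
rewrite (_ : (fun _ => _) =
  (fun n => \int[mu]_(r in `[0%R, t]) `|f' r - s' n r|%:E)%E)//.
apply/funext => n; apply: (@eq_integral_norm _ _ _ (f \- s' n) (f' \- s' n)).
by apply: filterS ff' => r ff' rt /=; rewrite ff'.
Qed.

Lemma Bochner_integrableE (t : R) (f : R -> E) : Bochner_integrable t f ->
  is_Bochner_integral t f (Bochner_integral t f).
Proof. by move=> [z fz]; rewrite /Bochner_integral; exact: (xgetI _ fz). Qed.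

(* If [f] is not integrable then the left-hand side is the junk value 0. *)
Lemma norm_Bochner_integral (t : R) (f : R -> E) :
  (`|Bochner_integral t f|%:E <= \int[mu]_(r in `[0%R, t]) `|f r|%:E)%E.
Proof.
rewrite /Bochner_integral; case: xgetP => [z _|_]; last first.
  by rewrite normr0 integral_ge0// => r _; rewrite lee_fin.
exact: norm_Bochner_integral_le.
Qed.

End bochner_existence.

Lemma cvg_to_at_right0 (R : realType) (u : nat -> R) :
  (forall n, 0 < u n <= n.+1%:R^-1) -> u n @[n --> \oo] --> 0^'+.
Proof.
move=> u0 A [e /= e0 HA].
have : \forall n \near \oo, n.+1%:R^-1 < (PosNum e0)%:num by exact: near_infty_natSinv_lt.
apply: filterS => n ne; have /andP[un0 une] := u0 n.
apply: HA => //=; rewrite sub0r normrN gtr0_norm//.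
exact: le_lt_trans une ne.
Qed.

(** [T t] is known to be linear only for nonnegative t, so the bundled linear map is built from a
    proof of linearity where it is needed. *)
Definition pack_linear (K : numFieldType) (V W : normedModType K) (f : V -> W)
  (lf : linear f) : {linear V -> W} :=
  HB.pack f (GRing.isLinear.Build _ _ _ _ _ lf).

Lemma linear_le_norm (K : realType) (V W : normedModType K) (f : V -> W) (M : K) :
  linear f -> (forall x, `|x| <= 1 -> `|f x| <= M) ->
  forall x, `|f x| <= M * `|x|.
Proof.
move=> lf fM x; pose g := pack_linear lf.
have [->|x0] := eqVneq x 0.
  by have f0 : f 0 = 0 := linear0 g; rewrite f0 !normr0 mulr0.
have nx0 : 0 < `|x| by rewrite normr_gt0.
have := fM (`|x|^-1 *: x); rewrite normrZ normfV normr_id mulVf ?gt_eqF// lexx.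
have fZ : f (`|x|^-1 *: x) = `|x|^-1 *: f x := linearZ_LR g _ _.
move=> /(_ isT); rewrite fZ normrZ normfV normr_id.
by rewrite ler_pdivrMl// mulrC.
Qed.

Lemma continuous_linear_le_norm (K : realType) (V W : normedModType K)
    (f : V -> W) : linear f -> continuous f ->
  exists2 C, 0 < C & forall x, `|f x| <= C * `|x|.
Proof.
move=> lf cf; pose g := pack_linear lf.
have /linear_bounded_continuous/linear_boundedP/pinfty_ex_gt0[C C0 HC] :
  continuous g by exact: cf.
by exists C.
Qed.

(** * C_0-semigroups *)

Section semigroup_theory.
Context (R : realType) (X : completeNormedModType R) (T : R -> X -> X).
Hypothesis hT : C0_semigroup T.

Lemma sg_linear t : 0 <= t -> linear (T t).
Proof. by case: hT => + _ _ _ t0 => /(_ t t0)[]. Qed.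

Lemma sg_continuous t : 0 <= t -> continuous (T t).
Proof. by case: hT => + _ _ _ t0 => /(_ t t0)[]. Qed.

Lemma sg0 x : T 0 x = x. Proof. by case: hT. Qed.

Lemma sgD s t x : 0 <= s -> 0 <= t -> T (s + t) x = T s (T t x).
Proof. by case: hT => _ _ + _; apply. Qed.

Lemma sg_cvg0 x : T t x @[t --> 0^'+] --> x. Proof. by case: hT. Qed.

Lemma sgB t x y : 0 <= t -> T t (x - y) = T t x - T t y.
Proof. by move=> t0; exact: (linearB (pack_linear (sg_linear t0))). Qed.

Lemma sg_add t x y : 0 <= t -> T t (x + y) = T t x + T t y.
Proof. by move=> t0; exact: (linearD (pack_linear (sg_linear t0))). Qed.

Lemma sg_at0 t : 0 <= t -> T t 0 = 0.
Proof. by move=> t0; exact: (linear0 (pack_linear (sg_linear t0))). Qed.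

(** Otherwise there are times t_n tending to 0 at which the norm of T(t_n) exceeds n. Each sequence
    T(t_n)x converges to x and is bounded, which contradicts the Banach-Steinhaus theorem. *)
Lemma sg_bounded_near0 : exists d K : R, [/\ 0 < d, 1 <= K &
  forall t x, 0 <= t <= d -> `|T t x| <= K * `|x|].
Proof.
suff [n Hn] : exists n : nat, forall t x, 0 < t <= n.+1%:R^-1 ->
    `|T t x| <= n%:R * `|x|.
  exists n.+1%:R^-1, n.+1%:R; split; rewrite ?invr_gt0 ?ler1n//.
  move=> t x /andP[]; rewrite le_eqVlt => /predU1P[<- _|t0 tn].
    by rewrite sg0 ler_peMl ?ler1n.
  apply: le_trans (Hn _ _ _) _; first by rewrite t0.
  by rewrite ler_wpM2r// ler_nat.
apply: contrapT => /forallNP nb.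
have /choice[u Hu] : forall n : nat, exists tx : R * X,
    0 < tx.1 <= n.+1%:R^-1 /\ n%:R * `|tx.2| < `|T tx.1 tx.2|.
  move=> n; apply: contrapT => /forallNP nbn; apply: (nb n) => t x tn.
  by rewrite leNgt; apply/negP => ltn; apply: (nbn (t, x)).
have u0 n : 0 <= (u n).1 by have [/andP[/ltW]] := Hu n.
have [||M HM] := @Banach_Steinhauss _ X X (range (fun n => T (u n).1)) _ _ 1.
- move=> _ [n _ <-]; split; last exact: sg_linear.
  have [C C0 HC] := continuous_linear_le_norm (sg_linear (u0 n)) (sg_continuous (u0 n)).
  move=> r; exists (C * r) => x xr; apply: le_trans (HC x) _.
  by rewrite ler_wpM2l// ltW.
- move=> x; have cT : T (u n).1 x @[n --> \oo] --> x.
    apply: (cvg_comp (fun n => (u n).1) (T ^~ x)); last exact: sg_cvg0.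
    by apply: cvg_to_at_right0 => n; exact: (Hu n).1.
  have /cvg_seq_bounded/pinfty_ex_gt0[M _ HM] : cvg (T (u n).1 x @[n --> \oo]).
    by apply/cvg_ex; exists x.
  by exists M => _ [n _ <-]; exact: HM.
have [un Hn] := Hu (Num.truncn M).+1.
move: Hn; apply/negP; rewrite -leNgt.
apply: le_trans (linear_le_norm (sg_linear (u0 _)) _ _) _.
- by move=> x x1; apply: HM => //; eexists.
- by rewrite ler_wpM2r// ltW// truncnS_gt.
Qed.

(** The interval [0, tau] is covered by steps of length d, and by the semigroup law each step costs
    a factor K. *)
Lemma sg_bounded tau : exists2 K : R, 1 <= K &
  forall t x, 0 <= t <= tau -> `|T t x| <= K * `|x|.
Proof.
have [d [K [d0 K1 HK]]] := sg_bounded_near0.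
have K0 : 0 <= K by rewrite (le_trans _ K1).
have Hn n t x : 0 <= t <= n%:R * d -> `|T t x| <= K ^+ n * `|x|.
  elim: n t x => [|n IH] t x.
    by rewrite mul0r -eq_le => /eqP <-; rewrite sg0 expr0 mul1r.
  move=> /andP[t0 tn]; have [td|dt] := leP t d.
    apply: le_trans (HK _ _ _) _; first by rewrite t0.
    by rewrite ler_wpM2r// exprS ler_peMr// exprn_ege1.
  rewrite -[t](subrKC d) sgD ?(ltW d0) ?subr_ge0 ?(ltW dt)//.
  apply: le_trans (HK _ _ _) _; first by rewrite (ltW d0) lexx.
  rewrite exprS -mulrA ler_wpM2l// IH// subr_ge0 (ltW dt)/= lerBlDr.
  by rewrite -natr1 mulrDl mul1r in tn.
pose n := (Num.truncn (tau / d)).+1.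
exists (K ^+ n); first exact: exprn_ege1.
move=> t x /andP[t0 tt]; apply: Hn; rewrite t0/= (le_trans tt)//.
by rewrite -ler_pdivrMr// ltW// truncnS_gt.
Qed.

Lemma sg_right_continuous a x : 0 <= a -> T t x @[t --> a^'+] --> T a x.
Proof.
move=> a0; have [C C0 HC] :=
  continuous_linear_le_norm (sg_linear a0) (sg_continuous a0).
apply/cvgrPdist_le => e e0; have eC0 : 0 < e / C by rewrite divr_gt0.
have /cvgrPdist_le/(_ _ eC0) [d /= d0 Hd] := @sg_cvg0 x.
exists d => // t /= td at_; have ta : 0 < t - a by rewrite subr_gt0.
have tE : t = a + (t - a) by rewrite subrKC.
rewrite [in T t x]tE sgD// ?(ltW ta)// -sgB//.
apply: le_trans (HC _) _; rewrite mulrC -ler_pdivlMr//; apply: Hd => //=.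
by rewrite sub0r normrN -normrN opprB.
Qed.

End semigroup_theory.

(** * Strong measurability by sampling on a grid *)

Section grid.
Context (R : realType).
Local Notation mu := (@lebesgue_measure R).
Local Notation MR := (measurableTypeR R).

(* [grid_point n (grid_index t n r)] is the first multiple of [n.+1%:R^-1]
   strictly above [r]: right-continuity controls the values there. *)
Definition grid_index (t : R) (n : nat) (r : R) : nat :=
  if r \in `[0, t]%classic then Num.truncn (n.+1%:R * r) else 0.

Definition grid_point (n k : nat) : R := k.+1%:R / n.+1%:R.

Lemma finitely_valued_grid_index (t : R) n :
  finitely_valued (grid_index t n : MR -> nat).
Proof.
split.
  apply: (@sub_finite_set _ _ `I_(Num.truncn (n.+1%:R * t)).+1) => //.
  move=> _ [r _ <-]; rewrite /grid_index /=.
  case: ifPn => // /set_mem; rewrite /= in_itv/= => /andP[r0 rt].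
  by rewrite ltnS le_truncn// ler_wpM2l.
move=> k; pose J : set MR := `[k%:R / n.+1%:R, k.+1%:R / n.+1%:R[%classic.
have mJ : measurable (`[0, t]%classic `&` J) by apply: measurableI => //; exact: measurable_itv.
have JE r : `[0, t]%classic r -> (grid_index t n r = k) <-> J r.
  move=> rt; rewrite /grid_index mem_set// /J /= in_itv/=.
  have r0 : 0 <= r by move: rt; rewrite /= in_itv/= => /andP[].
  have nr0 : 0 <= n.+1%:R * r by rewrite mulr_ge0.
  rewrite ler_pdivrMr// ltr_pdivlMr// ![r * _]mulrC -truncn_eq//.
  by split => [->|/eqP].
(* Index 0 is also the default value outside [0, t], so its level set contains the whole
   complement. *)
have [k0|k0] := eqVneq k 0.
  rewrite (_ : _ @^-1` _ = (`[0, t]%classic `&` J) `|` ~` `[0, t]%classic).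
    by apply: measurableU => //; exact: measurableC.
  apply/seteqP; split => r /=.
    have [rt|rt] := pselect (`[0, t]%classic r); last by right.
    by move/(JE _ rt); left.
  move=> [[rt /(JE _ rt)]//|rt].
  by rewrite /grid_index memNset.
rewrite (_ : _ @^-1` _ = (`[0, t]%classic `&` J))//.
apply/seteqP; split => r /=; last by move=> [rt /(JE _ rt)].
have [rt|rt] := pselect (`[0, t]%classic r); first by move/(JE _ rt).
by rewrite /grid_index memNset// => k0'; rewrite -k0' eqxx in k0.
Qed.

Lemma grid_pointP (t : R) n r : `[0, t]%classic r ->
  r < grid_point n (grid_index t n r) <= r + n.+1%:R^-1.
Proof.
move=> rt; rewrite /grid_index mem_set// /grid_point.
have r0 : 0 <= r by move: rt; rewrite /= in_itv/= => /andP[].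
have nr0 : 0 <= n.+1%:R * r by rewrite mulr_ge0.
have /andP[h1 h2] := truncn_itv nr0.
rewrite ltr_pdivlMr// mulrC h2/= ler_pdivrMr// mulrDl mulVf//.
by rewrite -[(Num.truncn _).+1%:R]natr1 lerD2r (mulrC r).
Qed.

Lemma cvg_grid_point (t r : R) : `[0, t]%classic r ->
  grid_point n (grid_index t n r) @[n --> \oo] --> r^'+.
Proof.
move=> rt A [e /= e0 HA].
have : \forall n \near \oo, n.+1%:R^-1 < (PosNum e0)%:num by exact: near_infty_natSinv_lt.
apply: filterS => n /= ne; have /andP[h1 h2] := grid_pointP n rt.
apply: HA => //=; rewrite distrC gtr0_norm ?subr_gt0//.
by rewrite ltrBlDl; apply: le_lt_trans h2 _; rewrite ltrD2l.
Qed.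

(** The function is sampled at the next grid point to the right. The minimum with t keeps the
    samples inside the interval, and at r = t every sample is f(t). *)
Lemma right_continuous_strongly_measurable (E : normedModType R) t (f : R -> E) :
  (forall r, 0 <= r < t -> f h @[h --> r^'+] --> f r) -> strongly_measurable t f.
Proof.
move=> cf; exists (fun n r => f (Num.min (grid_point n (grid_index t n r)) t)).
  move=> n; exact: (finitely_valued_comp (fun k => f (Num.min (grid_point n k) t))
    (finitely_valued_grid_index t n)).
apply: aeW => r rt; have := rt; rewrite /= in_itv/= => /andP[r0].
rewrite le_eqVlt => /predU1P[rE|ltrt].
  rewrite rE; apply: cvg_near_cst; apply: nearW => n.
  rewrite min_r// ltW//; have /andP[+ _] := grid_pointP n rt.
  by rewrite rE.
have /cf fr : 0 <= r < t by rewrite r0.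
have cg := cvg_grid_point rt.
apply: cvg_trans (cvg_comp _ _ cg fr); apply: near_eq_cvg.
have ht : \forall h \near r^'+, h <= t by exact: nbhs_right_le.
have gt : \forall n \near \oo, grid_point n (grid_index t n r) <= t := cg _ ht.
by apply: filterS gt => n gt; rewrite min_l.
Qed.

End grid.

Section convolution_measurable.
Context (R : realType) (X : completeNormedModType R) (T : R -> X -> X).
Hypothesis hT : C0_semigroup T.
Local Notation MR := (measurableTypeR R).

(** The semigroup is continuous in time only strongly, vector by vector. Freezing its time at grid
    points to the right of tau - s gives functions with finitely many values. *)
Lemma sg_strongly_measurable tau (f : R -> X) : strongly_measurable tau f ->
  strongly_measurable tau (fun s => T (tau - s) (f s)).
Proof.
move=> [s fs sf].
have fg n : finitely_valued ((fun r => grid_index tau n (tau - r)) : MR -> nat).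
  have [fi mi] := finitely_valued_grid_index tau n.
  split; first by apply: sub_finite_set fi => _ [r _ <-]; exists (tau - r).
  move=> k; have mt : measurable_fun (setT : set MR) (fun r : MR => tau - r : MR).
    by apply: measurable_funB => //; exact: measurable_cst.
  by have := mt measurableT _ (mi k); rewrite setTI.
exists (fun n r => T (grid_point R n (grid_index tau n (tau - r))) (s n r)).
  move=> n; exact: (finitely_valued_comp
    (fun z => T (grid_point R n z.1) z.2) (finitely_valued_pair (fg n) (fs n))).
apply: filterS sf => r sf rt; have {}sf := sf rt.
have tr : `[0, tau]%classic (tau - r).
  move: rt; rewrite /= !in_itv/= => /andP[r0 rt].
  by rewrite subr_ge0 rt/= gerBl.
have tr0 : 0 <= tau - r by move: tr; rewrite /= in_itv/= => /andP[].
(* A grid point exceeds tau - r by at most 1/(n+1) <= 1, so this horizon contains all of them. *)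
have [K K1 HK] := sg_bounded hT (tau - r + 1).
have K0 : 0 < K by rewrite (lt_le_trans _ K1).
have cT := cvg_comp _ _ (cvg_grid_point tr) (@sg_right_continuous _ _ _ hT _ (f r) tr0).
set g := fun n => grid_point R n (grid_index tau n (tau - r)) in cT *.
have gb n : 0 <= g n <= tau - r + 1.
  have /andP[h1 h2] := grid_pointP n tr.
  rewrite (le_trans tr0 (ltW h1))/=; apply: le_trans h2 _.
  by rewrite lerD2l invf_le1 ?ler1n.
(* Operator and vector move together: the uniform bound [K] absorbs the change of vector, and
   right-continuity handles T(g n) at the fixed vector f(r). *)
have cd : T (g n) (s n r) - T (g n) (f r) @[n --> \oo] --> 0.
  apply/cvgr0Pnorm_le => e e0; have eK : 0 < e / K by rewrite divr_gt0.
  have /cvgrPdist_le/(_ _ eK) := sf.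
  apply: filterS => n /= Hn; have /andP[g0 _] := gb n.
  rewrite -(sgB hT _ _ g0); apply: le_trans (HK _ _ (gb n)) _.
  by rewrite mulrC -ler_pdivlMr// distrC.
rewrite -[X in _ --> X]add0r (_ : (fun _ => _) =
  (fun n => T (g n) (s n r) - T (g n) (f r) + T (g n) (f r))).
  exact: cvgD.
by apply/funext => n; rewrite subrK.
Qed.

End convolution_measurable.

Lemma itv0S (R : realType) (t t' : R) : t' <= t ->
  `[0, t']%classic `<=` `[0, t]%classic.
Proof.
by move=> tt' r; rewrite /= !in_itv/= => /andP[-> /le_trans]; exact.
Qed.

Lemma ge0_subset_integralW d (T : measurableType d) (R : realType)
    (mu : {measure set T -> \bar R}) (D D' : set T) (f : T -> \bar R) :
  D `<=` D' -> (forall r, (0 <= f r)%E) ->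
  (\int[mu]_(r in D) f r <= \int[mu]_(r in D') f r)%E.
Proof.
move=> DD' f0; rewrite integral_mkcond [leRHS]integral_mkcond.
apply: ge0_le_integralW => r _; rewrite !patchE; case: ifPn => //.
  by move=> /set_mem/DD'/mem_set ->.
by case: ifP.
Qed.

(** * The input map *)

Section input_map_theory.
Context (R : realType) (X U : completeNormedModType R).
Context (T : R -> X -> X) (B : {linear U -> X}) (b : R).
Hypotheses (hT : C0_semigroup T) (hB : continuous B).
Hypotheses (b0 : 0 < b) (Bb : forall y, `|B y| <= b * `|y|).
Local Notation mu := (@lebesgue_measure R).
Local Notation MR := (measurableTypeR R).

(** On a bounded interval every exponent p >= 1 reduces to this case by [mem_Lp_L1]; a plain
    integral replaces the norm. *)
Definition mem_L1 (t : R) (u : R -> U) : Prop :=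
  strongly_measurable t u /\ (\int[mu]_(r in `[0%R, t]) `|u r|%:E < +oo)%E.

Lemma mem_L1S (t t' : R) u : t' <= t -> mem_L1 t u -> mem_L1 t' u.
Proof.
move=> tt' [mu_ iu]; split; first exact: strongly_measurableS mu_.
apply: le_lt_trans iu; apply: ge0_subset_integralW; first exact: itv0S.
by move=> r; rewrite lee_fin.
Qed.

(** The bound [k] on the semigroup stays general so that it can be a constant on bounded intervals
    or, in [norm_input_map], the exponential of a stable semigroup. *)
Lemma norm_convolution_integrand (k : R -> R) tau u s :
  (forall a, 0 <= k a) ->
  (forall a x, 0 <= a <= tau -> `|T a x| <= k a * `|x|) -> 0 <= s <= tau ->
  `|convolution_integrand T B tau u s| <= b * k (tau - s) * `|u s|.
Proof.
move=> k0 Tk /andP[s0 st]; rewrite /convolution_integrand.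
have a0 : 0 <= tau - s <= tau by rewrite subr_ge0 st/= gerBl.
apply: le_trans (Tk _ _ a0) _.
by rewrite [b * _]mulrC -mulrA ler_wpM2l.
Qed.

Lemma norm_input_map (k : R -> R) tau u : (forall a, 0 <= k a) ->
  (forall a x, 0 <= a <= tau -> `|T a x| <= k a * `|x|) ->
  (`|input_map T B tau u|%:E <=
   \int[mu]_(s in `[0%R, tau]) (b * k (tau - s) * `|u s|)%:E)%E.
Proof.
move=> k0 Tk; apply: le_trans (norm_Bochner_integral _ _) _.
apply: ge0_le_integralW => s; first by rewrite lee_fin.
rewrite /= in_itv/= => st; rewrite lee_fin; exact: norm_convolution_integrand.
Qed.

Lemma convolution_integrable tau u : mem_L1 tau u ->
  Bochner_integrable tau (convolution_integrand T B tau u).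
Proof.
move=> [mu_ iu]; apply: integrable_Bochner.
  apply: (@sg_strongly_measurable _ _ _ hT _ (B \o u)).
  exact: strongly_measurable_comp.
have [K K1 HK] := sg_bounded hT tau.
have K0 : 0 <= K by rewrite (le_trans _ K1).
apply: (@le_lt_trans _ _ (\int[mu]_(s in `[0%R, tau]) (b * K * `|u s|)%:E)%E).
  apply: ge0_le_integralW => s; first by rewrite lee_fin.
  rewrite /= in_itv/= => st; rewrite lee_fin.
  exact: (@norm_convolution_integrand (cst K)).
rewrite integral_normZ//; last by rewrite mulr_ge0// ltW.
by rewrite lte_mul_pinfty// lee_fin mulr_ge0// ltW.
Qed.

(** By the semigroup law T(h) T(r-s) = T(r+h-s), so the integrands cancel on [0, r] and only the
    input on ]r, r+h] remains. *)
Lemma input_map_step_le (K r h : R) u : 0 <= r -> 0 <= h -> 0 <= K ->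
  (forall a x, 0 <= a <= r + h -> `|T a x| <= K * `|x|) -> mem_L1 (r + h) u ->
  (`|input_map T B (r + h) u - T h (input_map T B r u)|%:E <=
   \int[mu]_(s in `]r, (r + h)%R]) (b * K * `|u s|)%:E)%E.
Proof.
move=> r0 h0 K0 HK u1.
have rh : r <= r + h by rewrite lerDl.
have I1 := Bochner_integrableE (convolution_integrable u1).
have I2 := Bochner_integrableE (convolution_integrable (mem_L1S rh u1)).
have [C C0 HC] :=
  continuous_linear_le_norm (sg_linear hT h0) (sg_continuous hT h0).
(* T(h) is moved under the integral and the result extended by zero, so that the difference becomes
   one Bochner integral over [0, r+h]. *)
have := @linear_is_Bochner_integral _ _ _ _ (pack_linear (sg_linear hT h0)) _ _ _
  HC (sg_continuous hT h0) I2.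
move=> /(is_Bochner_integral_cutoff rh) /(is_Bochner_integralB I1).
move=> /norm_Bochner_integral_le/le_trans; apply.
rewrite integral_mkcond [leRHS]integral_mkcond.
apply: ge0_le_integralW => s _; first by rewrite patchE; case: ifP.
rewrite !patchE; case: ifPn => [/set_mem|_]; last first.
  by case: ifPn => // _; rewrite lee_fin !mulr_ge0// ltW.
rewrite /= in_itv/= => /andP[s0 srh]; rewrite /cutoff.
have [sr|rs] := leP s r.
  have s1 : s \in `[0, r]%classic by rewrite inE/= in_itv/= s0.
  have /negbTE s2 : s \notin `]r, (r + h)]%classic.
    by rewrite notin_setE/= in_itv/= ltNge sr.
  rewrite /= s1 s2 /convolution_integrand -(sgD hT)// ?subr_ge0//.
  by rewrite addrA [h + r]addrC subrr normr0.
have /negbTE s1 : s \notin `[0, r]%classic.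
  by rewrite notin_setE/= in_itv/= s0/= leNgt rs.
have s2 : s \in `]r, (r + h)]%classic by rewrite inE/= in_itv/= rs.
rewrite /= s1 s2 subr0 lee_fin.
by apply: (@norm_convolution_integrand (cst K)) => //; rewrite s0.
Qed.

(** The increment is Phi_(r+h) u - T(h) Phi_r u, small by absolute continuity of the integral, plus
    T(h) Phi_r u - Phi_r u, small by strong continuity at the fixed vector Phi_r u. *)
Lemma input_map_right_continuous t u r : mem_L1 t u -> 0 <= r < t ->
  input_map T B h u @[h --> r^'+] --> input_map T B r u.
Proof.
move=> u1 /andP[r0 rt]; have [/strongly_measurableP[u' lu' uu'] iu] := u1.
have [K K1 HK] := sg_bounded hT t.
have K0 : 0 < K by rewrite (lt_le_trans _ K1).
(* Absolute continuity of the integral is applied on the whole line, hence the extension by zero. *)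
pose f : MR -> R := (fun s => `|u' s|) \_ `[0, t]%classic.
have intf : mu.-integrable setT (EFin \o f).
  rewrite /f -restrict_EFin; apply/(integrable_mkcond _ (measurable_itv0 t)).
  apply/integrableP; split; first exact: simple_limit_emeasurable.
  under eq_integral do rewrite /= normr_id.
  by rewrite -(eq_integral_norm uu').
apply/cvgrPdist_le => e e0.
have e1 : 0 < e / 2 / (b * K) by rewrite !divr_gt0// mulr_gt0.
have [d [d0 Hd]] := integral_normr_continuous intf e1.
have e2 : 0 < e / 2 by rewrite divr_gt0.
have /cvgrPdist_le/(_ _ e2) [d2 /= d20 Hd2] :=
  @sg_cvg0 _ _ _ hT (input_map T B r u).
near=> h'; pose h := h' - r; have h'E : h' = r + h by rewrite subrKC.
have h0 : 0 < h by rewrite subr_gt0; near: h'; exact: nbhs_right_gt.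
have h't : h' <= t by near: h'; exact: nbhs_right_le.
rewrite h'E in h't *.
have hd : h < d.
  by rewrite /h ltrBlDl; near: h'; apply: nbhs_right_lt; rewrite ltrDl.
have hd2 : h < d2.
  by rewrite /h ltrBlDl; near: h'; apply: nbhs_right_lt; rewrite ltrDl.
rewrite -(subrKA (T h (input_map T B r u))); apply: le_trans (ler_normD _ _) _.
rewrite [leRHS]splitr; apply: lerD.
  by apply: Hd2 => //=; rewrite sub0r normrN gtr0_norm.
rewrite distrC -lee_fin.
apply: le_trans (@input_map_step_le K _ _ _ r0 (ltW h0) (ltW K0) _ _) _.
- move=> a x /andP[a0 arh]; apply: HK; rewrite a0/=; exact: le_trans h't.
- exact: mem_L1S h't u1.
have mJ : measurable (`]r, (r + h)]%classic : set MR) by exact: measurable_itv.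
have JS : `]r, (r + h)]%classic `<=` `[0, t]%classic.
  move=> s /=; rewrite !in_itv/= => /andP[rs srh].
  by rewrite (le_trans r0 (ltW rs)) (le_trans srh).
have -> : (\int[mu]_(s in `]r, (r + h)%R]) (b * K * `|u s|)%:E)%E =
    (\int[mu]_(s in `]r, (r + h)%R]) ((b * K)%:E * `|f s|%:E))%E.
  apply: ge0_ae_eq_integralW => [s _|s _|].
  - by rewrite lee_fin !mulr_ge0// ltW.
  - by rewrite lee_fin !mulr_ge0// ltW.
  apply: filterS uu' => s uu' sJ; rewrite uu'; last exact: JS.
  by rewrite /f patchE mem_set ?normr_id ?EFinM//; exact: JS.
have mf : measurable_fun (`]r, (r + h)]%classic : set MR) (fun s => `|f s|%:E).
  apply/measurable_EFinP; apply: measurable_funTS; apply: measurableT_comp => //.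
  by case/integrableP : intf => /measurable_EFinP.
rewrite ge0_integralZl_EFin//; last by rewrite mulr_ge0// ltW.
have muJ : (mu `]r, (r + h)%R]%classic < d%:E)%E.
  by rewrite lebesgue_measure_itv/= lte_fin ltrDl h0 -EFinB addrC addKr lte_fin.
have := Hd _ mJ muJ; rewrite ltr_pdivlMr ?mulr_gt0// mulrC => /ltW.
rewrite -lee_fin EFinM fineK//.
rewrite ge0_fin_numE; last by apply: integral_ge0 => s _; rewrite lee_fin.
case/integrableP : intf => _; apply: le_lt_trans.
exact: ge0_subset_integralW.
Unshelve. all: by end_near. Qed.

Lemma input_map_strongly_measurable t u : mem_L1 t u ->
  strongly_measurable t (input_map T B ^~ u).
Proof.
move=> u1; apply: right_continuous_strongly_measurable => r rt.
exact: input_map_right_continuous u1 rt.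
Qed.

End input_map_theory.

(** * Exponential convolutions *)

Section exponential_integrals.
Context (R : realType).
Local Notation mu := (@lebesgue_measure R).
Local Notation MR := (measurableTypeR R).

Lemma is_derive_expR_affine (c d s : R) : c != 0 ->
  is_derive s 1 (fun s : R => c^-1 * expR (c * s + d)) (expR (c * s + d)).
Proof.
move=> c0.
have ha : is_derive s 1 (fun s : R => c * s + d) c.
  by apply: is_derive_eq; rewrite addr0 /GRing.scale/= mulr1.
have he := @is_derive1_comp R expR (fun s => c * s + d) s _ _ (is_derive_expR _) ha.
have hz := is_deriveZ c^-1 he.
have -> : expR (c * s + d) = c^-1 *: (expR (c * s + d) * c).
  by rewrite /GRing.scale/= mulrCA mulVf// mulr1.
exact: hz.
Qed.

Lemma integral_expR_affine (a b c d : R) : a < b -> c != 0 ->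
  (\int[mu]_(s in `[a, b]) (expR (c * s + d))%:E =
   (c^-1 * (expR (c * b + d) - expR (c * a + d)))%:E)%E.
Proof.
move=> ab c0; pose F s := c^-1 * expR (c * s + d).
have dF (s : R) : is_derive s 1 F (expR (c * s + d)) := is_derive_expR_affine d s c0.
have cF : continuous F.
  move=> s; apply/differentiable_continuous/derivable1_diffP.
  by have [] := dF s.
rewrite (@continuous_FTC2 _ _ F)//.
- by rewrite -EFinB -mulrBr.
- apply: continuous_subspaceT => s; apply: continuous_comp; last exact: continuous_expR.
  by apply: continuousD; [apply: continuousM; [exact: cvg_cst|exact: cvg_id]|exact: cvg_cst].
- split=> [s _||]; first by have [] := dF s.
  + by apply: cvg_at_right_filter; exact: cF.
  + by apply: cvg_at_left_filter; exact: cF.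
- by move=> s _; rewrite derive1E; have [] := dF s.
Qed.

Lemma integral_expR_decay_le (a b w : R) : 0 < w ->
  (\int[mu]_(r in `[a, b]) (expR (- w * (r - a)))%:E <= (w^-1)%:E)%E.
Proof.
move=> w0; have w0' : - w != 0 by rewrite oppr_eq0 gt_eqF.
have [ab|ba] := ltP a b; last first.
  rewrite null_set_integral//=; last by rewrite lebesgue_measure_itv/= lte_fin ltNge ba.
    by rewrite lee_fin invr_ge0 ltW.
  apply/measurable_EFinP; apply: measurableT_comp => //.
  by apply: measurable_funM => //; apply: measurable_funB.
under eq_integral do rewrite mulrBr.
rewrite integral_expR_affine// lee_fin.
rewrite [- w * a - _]addrN expR0 invrN mulNr -mulrN opprB.
by rewrite ler_piMr ?invr_ge0 ?(ltW w0)// gerBl expR_ge0.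
Qed.

Lemma integral_expR_growth_le (a b w : R) : 0 < w ->
  (\int[mu]_(s in `[a, b]) (expR (- w * (b - s)))%:E <= (w^-1)%:E)%E.
Proof.
move=> w0; have w0' : w != 0 by rewrite gt_eqF.
have [ab|ba] := ltP a b; last first.
  rewrite null_set_integral//=; last by rewrite lebesgue_measure_itv/= lte_fin ltNge ba.
    by rewrite lee_fin invr_ge0 ltW.
  apply/measurable_EFinP; apply: measurableT_comp => //.
  by apply: measurable_funM => //; apply: measurable_funB.
under eq_integral do rewrite mulNr mulrBr opprB.
rewrite integral_expR_affine// lee_fin subrr expR0.
by rewrite ler_piMr ?invr_ge0 ?(ltW w0)// gerBl expR_ge0.
Qed.

End exponential_integrals.

Section exponential_convolution.
Context (R : realType) (w : R) (t : R).
Local Notation mu := (@lebesgue_measure R).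
Local Notation MR := (measurableTypeR R).
Variable g : MR -> R.
Hypotheses (w0 : 0 < w) (g0 : forall s, 0 <= g s).
Hypothesis mg : measurable_fun (setT : set MR) g.

Definition exp_conv (r : R) : \bar R :=
  (\int[mu]_(s in `[0%R, r]) (expR (- w * (r - s)) * g s)%:E)%E.

Let N := (\int[mu]_(s in `[0%R, t]) (g s)%:E)%E.

Lemma exp_conv_ge0 r : (0 <= exp_conv r)%E.
Proof. by apply: integral_ge0 => s _; rewrite lee_fin mulr_ge0 ?expR_ge0. Qed.

Lemma exp_conv_le r : r <= t -> (exp_conv r <= N)%E.
Proof.
move=> rt; apply: (@le_trans _ _ (\int[mu]_(s in `[0%R, r]) (g s)%:E)%E).
  apply: ge0_le_integralW => s; first by rewrite lee_fin mulr_ge0 ?expR_ge0.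
  rewrite /= in_itv/= => /andP[_ sr]; rewrite lee_fin ler_piMl//.
  by rewrite expR_le1 mulNr oppr_le0 mulr_ge0 ?(ltW w0)// subr_ge0.
by apply: ge0_subset_integralW; [exact: itv0S|move=> s; rewrite lee_fin].
Qed.

(** The triangle s <= r. Cutting the kernel off to it turns the variable limit of integration into
    sections over the whole line, the form required by Tonelli. *)
Let A : set (MR * MR) :=
  (`[0, t]%classic `*` `[0, t]%classic) `&` [set z | z.2 <= z.1].

Let F (z : MR * MR) : \bar R :=
  (\1_A z * (expR (- w * (z.1 - z.2)) * g z.2))%:E.

Let mA : measurable A.
Proof.
apply: measurableI; first by apply: measurableX; exact: measurable_itv0.
rewrite -[X in measurable X]setTI.
apply: (@measurable_fun_le _ (MR * MR)%type _ _ (fun z => z.2) (fun z => z.1)) => //.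
  exact: measurable_snd.
exact: measurable_fst.
Qed.

Let mF : measurable_fun setT F.
Proof.
apply/measurable_EFinP; apply: measurable_funM; first exact: measurable_indic.
apply: measurable_funM; last exact: measurableT_comp mg _.
apply: measurableT_comp => //; apply: measurable_funM => //.
exact: measurable_funB.
Qed.

Let F0 z : (0 <= F z)%E.
Proof. by rewrite lee_fin !mulr_ge0 ?expR_ge0. Qed.

Let FE r : `[0, t]%classic r -> exp_conv r = (\int[mu]_s F (r, s))%E.
Proof.
move=> rt; rewrite /exp_conv integral_mkcond; apply: eq_integral => s _.
rewrite patchE /F indicE; case: ifPn => [/set_mem sr|sr].
  rewrite mem_set ?mul1r//; move: rt sr; rewrite /A /= !in_itv/=.
  by move=> /andP[-> rt] /andP[-> sr]; rewrite rt (le_trans sr rt).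
rewrite memNset ?mul0r//; apply: contraNnot sr => -[[_ /=]].
by rewrite !in_itv/= => /andP[s0 _] sr; rewrite inE/= in_itv/= s0.
Qed.

Lemma measurable_exp_conv :
  measurable_fun (`[0, t]%classic : set MR) exp_conv.
Proof.
apply: (@eq_measurable_fun _ _ _ _ _ (fun r => \int[mu]_s F (r, s))%E).
  by move=> r /set_mem rt; rewrite FE.
by apply: measurable_funTS; exact: measurable_fun_fubini_tonelli_F.
Qed.

Lemma integral_exp_conv_le :
  (\int[mu]_(r in `[0%R, t]) exp_conv r <= (w^-1)%:E * N)%E.
Proof.
apply: (@le_trans _ _ (\int[mu]_r \int[mu]_s F (r, s))%E).
  rewrite integral_mkcond; apply: ge0_le_integralW => r _.
    by rewrite patchE; case: ifPn => // _; exact: exp_conv_ge0.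
  rewrite patchE; case: ifPn => [/set_mem rt|_]; first by rewrite FE.
  exact: integral_ge0.
rewrite fubini_tonelli// -ge0_integralZl_EFin//; last 3 first.
- by move=> s _; rewrite lee_fin.
- by apply/measurable_EFinP; exact: measurable_funTS.
- by rewrite invr_ge0 ltW.
rewrite [leRHS]integral_mkcond; apply: ge0_le_integralW => s _.
  exact: integral_ge0.
rewrite patchE; case: ifPn => [/set_mem st|sN]; last first.
  rewrite integral0_eq// => r _; rewrite /F indicE memNset ?mul0r// => -[[_ /= s1] _].
  by move: sN; rewrite mem_set.
(* For fixed s the section of the triangle lies in [s, t], where the kernel has integral at most 1/w
   whatever s and t are. *)
apply: (@le_trans _ _ (\int[mu]_(r in `[s, t]) ((g s)%:E * (expR (- w * (r - s)))%:E))%E).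
  rewrite [leRHS]integral_mkcond; apply: ge0_le_integralW => r _; first exact: F0.
  rewrite patchE /F indicE; have [zA|zA] := boolP ((r, s) \in A).
    rewrite mem_set ?mul1r ?[_ * g s]mulrC//=.
    move/set_mem: zA => [[/= r1 _] /= sr]; move: r1.
    by rewrite !in_itv/= sr => /andP[].
  by rewrite mul0r; case: ifPn => // _; rewrite mule_ge0 ?lee_fin ?expR_ge0.
rewrite ge0_integralZl_EFin//; last first.
  apply/measurable_EFinP; apply: measurableT_comp => //.
  by apply: measurable_funM => //; apply: measurable_funB.
rewrite [leRHS]muleC; apply: lee_wpmul2l; first by rewrite lee_fin.
exact: integral_expR_decay_le.
Qed.

End exponential_convolution.

(** * L^p norms of representatives and inequalities between powers *)

Section Lp_representatives.
Context (R : realType) (E : normedModType R).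
Local Notation mu := (@lebesgue_measure R).
Local Notation MR := (measurableTypeR R).

Lemma eLp_normE (p t : R) (f : R -> E) : p != 0 ->
  eLp_norm p t f = ((\int[mu]_(r in `[0%R, t]) (`|f r| `^ p)%:E) `^ p^-1)%E.
Proof.
move=> p0; rewrite /eLp_norm unlock; congr (_ `^ _)%E.
rewrite [RHS]integral_mkcond; apply: eq_integral => r _.
rewrite !patchE; case: ifPn => _; first by rewrite gee0_abs ?lee_fin// poweR_EFin.
by rewrite abse0 poweR0r.
Qed.

Lemma mem_Lp_integral (p t : R) (f : R -> E) : 0 < p -> mem_Lp p t f ->
  (\int[mu]_(r in `[0%R, t]) (`|f r| `^ p)%:E = (Lp_norm p t f `^ p)%:E)%E.
Proof.
move=> p0 [_]; rewrite /Lp_norm eLp_normE ?gt_eqF//.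
set I := (integral _ _ _) => /lty_poweRy; rewrite invr_eq0 gt_eqF// => /(_ isT) Ioo.
have I0 : (0 <= I)%E by apply: integral_ge0 => r _; rewrite lee_fin powR_ge0.
have If : I \is a fin_num by rewrite ge0_fin_numE.
rewrite fine_poweR -powRrM mulVf ?gt_eqF// powRr1 ?fine_ge0//.
by rewrite fineK.
Qed.

Lemma Lp_norm_ge0 (p t : R) (f : R -> E) : 0 <= Lp_norm p t f.
Proof. by apply: fine_ge0; exact: Lnorm_ge0. Qed.

Lemma integral_powR_repr (p t : R) (f f' : R -> E) :
  {ae mu, forall r, `[0, t]%classic r -> f r = f' r} ->
  (\int[mu]_(r in `[0%R, t]) (`|f r| `^ p)%:E =
   \int[mu]_(r in `[0%R, t]) (`|f' r| `^ p)%:E)%E.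
Proof.
move=> ff'; apply: ge0_ae_eq_integralW => [r _|r _|]; [by rewrite lee_fin powR_ge0..|].
by apply: filterS ff' => r ff' rt; rewrite ff'.
Qed.

Lemma measurable_norm_powR (p : R) (f : R -> E) : simple_limit f ->
  measurable_fun (setT : set MR) (fun r => `|f r| `^ p).
Proof.
move=> lf; apply: (measurableT_comp (measurable_powR p)).
exact: simple_limit_measurable_norm.
Qed.

(** Since v <= 1 + v^p, integrability of the p-th power suffices on a bounded interval. *)
Lemma mem_Lp_L1 (p t : R) (f : R -> E) : 1 <= p -> mem_Lp p t f ->
  strongly_measurable t f /\ (\int[mu]_(r in `[0%R, t]) `|f r|%:E < +oo)%E.
Proof.
move=> p1 Lf; have p0 : 0 < p by rewrite (lt_le_trans _ p1).
have [/[dup] mf /strongly_measurableP[f' lf' ff'] _] := Lf; split => //.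
have := mem_Lp_integral p0 Lf.
rewrite (integral_powR_repr _ ff') (eq_integral_norm ff') => If.
apply: (@le_lt_trans _ _ (\int[mu]_(r in `[0%R, t]) (1%:E + (`|f' r| `^ p)%:E))%E).
  apply: ge0_le_integralW => r _; first by rewrite lee_fin.
  rewrite lee_fin; have [f1|f1] := leP `|f' r| 1.
    by rewrite (le_trans f1)// lerDl powR_ge0.
  by rewrite (le_trans (le1r_powR (ltW f1) p1))// lerDr.
rewrite ge0_integralD//; last first.
  by apply/measurable_EFinP/measurable_funTS; exact: measurable_norm_powR.
rewrite If integral_cst// mul1e.
by apply: lte_add_pinfty; [exact: fin_itv|exact: ltry].
Qed.

End Lp_representatives.

Section powR_lemmas.
Context (R : realType).

(* Interpolating [v] between a constant and [v `^ p] replaces Hoelder's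
   inequality; the choice [l = y `^ p^-1] is made in [interpolation_optimal]. *)
Lemma le_interpolation (l v p : R) : 0 < l -> 0 <= v -> 1 <= p ->
  v <= l + l `^ (1 - p) * v `^ p.
Proof.
move=> l0 v0 p1; have [vl|lv] := leP v l.
  by apply: le_trans vl _; rewrite lerDl mulr_ge0 ?powR_ge0.
have v1 : 0 < v := lt_trans l0 lv.
have p0 : 0 < p by rewrite (lt_le_trans _ p1).
rewrite -[leLHS]add0r lerD ?(ltW l0)//.
rewrite -[v `^ p]mulr_powRB1// mulrCA ler_peMr//.
rewrite -opprB powRN mulrC ler_pdivlMr ?powR_gt0// mul1r.
by apply: ge0_ler_powR; rewrite ?nnegrE ?subr_ge0// ltW.
Qed.

Lemma interpolation_optimal (a y k p : R) : 0 <= y -> 0 <= k -> 1 <= p ->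
  (forall l, 0 < l -> a <= l * k + l `^ (1 - p) * y) ->
  a <= (k + 1) * y `^ p^-1.
Proof.
move=> y0 k0 p1 H; have p0 : 0 < p by rewrite (lt_le_trans _ p1).
have [yp|] := ltP 0 y.
  apply: le_trans (H (y `^ p^-1) _) _; first exact: powR_gt0.
  rewrite mulrDl mul1r [k * _]mulrC lerD2l -powRrM mulrBr mulr1 mulVf ?gt_eqF//.
  rewrite -{2}[y]powRr1// -powRD ?subrK//.
  by rewrite (gt_eqF yp) implybT.
move=> yn; have -> : y = 0 by apply/eqP; rewrite eq_le yn.
rewrite powR0 ?invr_eq0 ?gt_eqF// mulr0.
rewrite leNgt; apply/negP => a0.
(* For y = 0 the balancing choice of l would be 0. The hypothesis then reads a <= l k for all l > 0,
   and this l makes l k smaller than a. *)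
have l0 : 0 < a / (2 * (k + 1)) by rewrite divr_gt0// mulr_gt0// ltr_wpDl.
have yE : y = 0 by apply/eqP; rewrite eq_le yn.
have := H _ l0; rewrite yE mulr0 addr0 leNgt => /negP; apply.
rewrite mulrAC ltr_pdivrMr; last by rewrite mulr_gt0// ltr_wpDl.
rewrite ltr_pM2l//; lra.
Qed.

Lemma powRD_le (x y q : R) : 0 <= x -> 0 <= y -> 0 <= q ->
  (x + y) `^ q <= 2 `^ q * (x `^ q + y `^ q).
Proof.
move=> x0 y0 q0.
wlog xy : x y x0 y0 / x <= y.
  move=> H; have [xy|/ltW yx] := leP x y; first exact: H.
  by rewrite addrC [x `^ q + _]addrC; exact: H.
apply: (@le_trans _ _ ((2 * y) `^ q)).
  by apply: ge0_ler_powR; rewrite ?nnegrE ?addr_ge0 ?mulr_ge0//; lra.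
by rewrite powRM// ler_wpM2l ?powR_ge0// lerDr powR_ge0.
Qed.

End powR_lemmas.

(** * Exponential stability *)

Section exponential_stability.
Context (R : realType) (X : completeNormedModType R) (T : R -> X -> X).
Hypothesis hT : C0_semigroup T.

(** The real-valued [sup] is a genuine supremum only for nonempty bounded sets; continuity of [T t]
    provides the bound. *)
Lemma has_sup_operator_norm t : 0 <= t ->
  has_sup [set `|T t x| | x in [set x | `|x| <= 1]].
Proof.
move=> t0; split; first by exists `|T t 0|, 0 => //=; rewrite normr0.
have [C C0 HC] :=
  continuous_linear_le_norm (sg_linear hT t0) (sg_continuous hT t0).
exists C => _ [x /= x1 <-]; apply: le_trans (HC x) _.
by rewrite ler_piMr// ltW.
Qed.

Lemma operator_norm_leP t C : 0 <= t -> 0 <= C ->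
  operator_norm (T t) <= C <-> forall x, `|T t x| <= C * `|x|.
Proof.
move=> t0 C0; split=> [TC x|TC].
  apply: linear_le_norm; first exact: sg_linear.
  move=> y y1; apply: le_trans TC; apply: sup_upper_bound => //.
    exact: has_sup_operator_norm.
  by exists y.
apply: ge_sup; first by case: (has_sup_operator_norm t0).
move=> _ [x /= x1 <-]; apply: le_trans (TC x) _.
by rewrite ler_piMr.
Qed.

Lemma exponentially_stableP : exponentially_stable T <->
  exists M w : R, [/\ 0 < M, 0 < w &
    forall t x, 0 <= t -> `|T t x| <= M * expR (- w * t) * `|x|].
Proof.
split=> -[M [w [M0 w0 H]]]; exists M, w; split => //.
  move=> t x t0; move: x; apply/operator_norm_leP => //; last exact: H.
  by rewrite mulr_ge0 ?expR_ge0// ltW.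
move=> t t0; apply/operator_norm_leP => //.
  by rewrite mulr_ge0 ?expR_ge0// ltW.
by move=> x; exact: H.
Qed.

Lemma contraction_exponentially_stable tau : 0 < tau ->
  (forall x, `|x| <= 1 -> `|T tau x| <= 2^-1) -> exponentially_stable T.
Proof.
move=> tau0 Htau; have t0 := ltW tau0.
have Hx x : `|T tau x| <= 2^-1 * `|x| := linear_le_norm (sg_linear hT t0) Htau x.
have [K K1 HK] := sg_bounded hT tau.
have K0 : 0 < K by rewrite (lt_le_trans _ K1).
have Hn n s x : 0 <= s <= tau -> `|T (n%:R * tau + s) x| <= 2^-1 ^+ n * K * `|x|.
  move=> s0t; have /andP[s0 _] := s0t.
  elim: n => [|n IH]; first by rewrite mul0r add0r expr0 mul1r HK.
  rewrite -natr1 mulrDl mul1r addrAC addrC sgD//; last first.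
    by rewrite addr_ge0// mulr_ge0.
  apply: le_trans (Hx _) _; rewrite exprS -!mulrA ler_wpM2l//.
  by rewrite mulrA.
(* With this rate the exponential halves over each period tau, as the contraction does. [K] covers
   the remaining time, and the factor 2 pays for rounding t / tau down. *)
apply/exponentially_stableP; exists (2 * K), (ln 2 / tau); split.
- by rewrite mulr_gt0.
- by rewrite divr_gt0// ln_gt0// ltr1n.
move=> t x tt0; pose n := Num.truncn (t / tau).
have tt : 0 <= t / tau by rewrite divr_ge0.
have /andP[n1 n2] := truncn_itv tt.
have tE : t = n%:R * tau + (t - n%:R * tau) by rewrite subrKC.
rewrite [in T t]tE; apply: le_trans (Hn _ _ _ _) _.
  rewrite subr_ge0 -ler_pdivlMr// n1/= lerBlDl -[X in _ + X]mul1r -mulrDl natr1.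
  by rewrite -ler_pdivrMr// ltW.
rewrite ler_wpM2r// mulrAC ler_wpM2r ?(ltW K0)//.
have -> : expR (- (ln 2 / tau) * t) = expR (- (ln 2 * (t / tau))).
  by congr expR; field; rewrite gt_eqF.
apply: (@le_trans _ _ (2 * expR (- (ln 2 * n.+1%:R)))); last first.
  by rewrite ler_wpM2l// ler_expR lerN2 ler_wpM2l ?ln_ge0 ?ler1n// ltW.
rewrite expRN expRM_natr lnK ?posrE//.
by rewrite exprVn exprS invfM mulrA mulfV// mul1r.
Qed.

End exponential_stability.

(** * Estimates for the input map of an exponentially stable semigroup *)

Section stable_estimates.
Context (R : realType) (X U : completeNormedModType R).
Context (T : R -> X -> X) (B : {linear U -> X}) (b M w : R).
Hypotheses (hT : C0_semigroup T) (hB : continuous B).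
Hypotheses (b0 : 0 < b) (Bb : forall y, `|B y| <= b * `|y|).
Hypotheses (M0 : 0 < M) (w0 : 0 < w).
Hypothesis Tw : forall t x, 0 <= t -> `|T t x| <= M * expR (- w * t) * `|x|.
Local Notation mu := (@lebesgue_measure R).
Local Notation MR := (measurableTypeR R).
Let gain : R := b * M * (w^-1 + 1).

Let gain_gt0 : 0 < gain.
Proof. by rewrite !mulr_gt0// addr_gt0// invr_gt0. Qed.

(** A single [g] serves all r in [0, t], so the pointwise bound can afterwards be integrated in r.
    It is the p-th power of the norm of a representative of u, which makes it measurable. *)
Lemma input_map_le_exp_conv p t u : 1 <= p -> mem_Lp p t u ->
  exists g : MR -> R, [/\ measurable_fun setT g, forall s, 0 <= g s,
    (\int[mu]_(s in `[0%R, t]) (g s)%:E = (Lp_norm p t u `^ p)%:E)%E &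
    forall r, 0 <= r <= t ->
      `|input_map T B r u| <= gain * fine (exp_conv w g r) `^ p^-1].
Proof.
move=> p1 Lu; have p0 : 0 < p by rewrite (lt_le_trans _ p1).
have [/strongly_measurableP[u' lu' uu'] _] := Lu.
pose g : MR -> R := fun s => `|u' s| `^ p.
have g0 s : 0 <= g s by exact: powR_ge0.
have mg : measurable_fun setT g by exact: measurable_norm_powR.
have Ig : (\int[mu]_(s in `[0%R, t]) (g s)%:E = (Lp_norm p t u `^ p)%:E)%E.
  by rewrite -(mem_Lp_integral p0 Lu) (integral_powR_repr _ uu').
exists g; split => // r /andP[r0 rt].
have Yfin : exp_conv w g r \is a fin_num.
  rewrite ge0_fin_numE ?exp_conv_ge0//.
  apply: le_lt_trans (exp_conv_le w0 g0 rt) _.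
  by rewrite [X in (X < _)%E]Ig ltry.
have bM0 : 0 < b * M by rewrite mulr_gt0.
rewrite /gain -mulrA -ler_pdivrMl//.
apply: interpolation_optimal => //; first by rewrite fine_ge0 ?exp_conv_ge0.
  by rewrite invr_ge0 ltW.
have YE := fineK Yfin; set y := fine _ in YE *.
move=> l l0; rewrite ler_pdivrMl// -lee_fin.
have k0 a : 0 <= M * expR (- w * a) by rewrite mulr_ge0 ?expR_ge0// ltW.
apply: le_trans (norm_input_map Bb _ k0 _) _.
  by move=> a x /andP[a0 _]; exact: Tw.
have me : measurable_fun (`[0, r]%classic : set MR)
    (fun s => (expR (- w * (r - s)))%:E).
  apply/measurable_EFinP; apply: measurableT_comp => //.
  by apply: measurable_funM => //; apply: measurable_funB.
have lp0 : 0 <= l `^ (1 - p) by exact: powR_ge0.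
(* The interpolation inequality, with l still free, is multiplied by the kernel; the choice of l is
   left to [interpolation_optimal]. *)
apply: (@le_trans _ _ (\int[mu]_(s in `[0%R, r])
    ((b * M * l)%:E * (expR (- w * (r - s)))%:E +
     (b * M * l `^ (1 - p))%:E * (expR (- w * (r - s)) * g s)%:E))%E).
  apply: ae_le_integral => [s _|s _|].
  - by rewrite lee_fin !mulr_ge0 ?expR_ge0// ltW.
  - by rewrite -!EFinM -EFinD lee_fin addr_ge0// !mulr_ge0 ?expR_ge0// ltW.
  apply: filterS uu' => s uu' sr; rewrite uu'; last exact: itv0S sr.
  rewrite -!EFinM -EFinD lee_fin.
  have := le_interpolation l0 (normr_ge0 (u' s)) p1.
  move/(ler_wpM2l (_ : 0 <= b * M * expR (- w * (r - s)))) => /(_ _)/le_trans H.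
  rewrite mulrA; apply: H; first by rewrite !mulr_ge0 ?expR_ge0// ltW.
  by rewrite /g le_eqVlt; apply/orP; left; apply/eqP; ring.
rewrite ge0_integralD//; last 4 first.
- by move=> s _; rewrite -EFinM lee_fin !mulr_ge0 ?expR_ge0// ltW.
- exact: measurable_funeM.
- by move=> s _; rewrite -EFinM lee_fin !mulr_ge0 ?expR_ge0// ltW.
- apply: measurable_funeM; apply/measurable_EFinP; apply: measurable_funM.
    by apply/measurable_EFinP.
  exact: measurable_funTS.
rewrite ge0_integralZl_EFin//; last by rewrite !mulr_ge0// ltW.
rewrite ge0_integralZl_EFin//; last 3 first.
- by move=> s _; rewrite lee_fin mulr_ge0 ?expR_ge0.
- apply/measurable_EFinP; apply: measurable_funM; first by apply/measurable_EFinP.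
  exact: measurable_funTS.
- by rewrite !mulr_ge0// ltW.
rewrite [X in (_ + _ * X <= _)%E](_ : _ = y%:E); last by rewrite YE.
rewrite mulrDr EFinD !mulrA [X in (_ <= X + _)%E]EFinM [X in (_ <= _ + X)%E]EFinM.
apply: leeD => //; apply: lee_wpmul2l; first by rewrite lee_fin !mulr_ge0// ltW.
exact: integral_expR_growth_le.
Qed.

Lemma norm_input_map_Lp p t u : 1 <= p -> 0 <= t -> mem_Lp p t u ->
  `|input_map T B t u| <= gain * Lp_norm p t u.
Proof.
move=> p1 t0 Lu; have p0 : 0 < p by rewrite (lt_le_trans _ p1).
have [g [mg g0 Ig H]] := input_map_le_exp_conv p1 Lu.
have := exp_conv_le w0 g0 (lexx t); rewrite [X in (_ <= X)%E]Ig => Yle.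
apply: le_trans (H t _) _; first by rewrite t0 lexx.
rewrite ler_wpM2l ?(ltW gain_gt0)//.
rewrite -[leRHS](_ : (Lp_norm p t u `^ p) `^ p^-1 = _); last first.
  by rewrite -powRrM mulfV ?gt_eqF// powRr1// Lp_norm_ge0.
apply: ge0_ler_powR; rewrite ?nnegrE ?invr_ge0 ?powR_ge0 ?(ltW p0)//.
  by rewrite fine_ge0// exp_conv_ge0.
by have := exp_conv_ge0 w g0 t; move: Yle; case: exp_conv.
Qed.

(** This is where p <= q enters. With N = |u|_p^p, the bound y <= N gives y^(q/p) <= N^(q/p - 1) y,
    and the integral of y is at most N / w. *)
Lemma integral_input_map_powR p q t u : 1 <= p -> p <= q -> mem_Lp p t u ->
  (\int[mu]_(r in `[0%R, t]) (`|input_map T B r u| `^ q)%:E <=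
   (w^-1 * (gain * Lp_norm p t u) `^ q)%:E)%E.
Proof.
move=> p1 pq Lu; have p0 : 0 < p by rewrite (lt_le_trans _ p1).
have q0 : 0 < q by rewrite (lt_le_trans p0).
have [g [mg g0 Ig H]] := input_map_le_exp_conv p1 Lu.
set S := Lp_norm p t u in Ig *; have S0 : 0 <= S by exact: Lp_norm_ge0.
pose Nq := (S `^ p) `^ (q / p - 1).
have qp : 0 <= q / p - 1 by rewrite subr_ge0 ler_pdivlMr// mul1r.
have gq : 0 <= gain `^ q * Nq by rewrite mulr_ge0// powR_ge0.
apply: (@le_trans _ _ (\int[mu]_(r in `[0%R, t])
    ((gain `^ q * Nq)%:E * exp_conv w g r))%E).
  apply: ge0_le_integralW => r; first by rewrite lee_fin powR_ge0.
  rewrite /= in_itv/= => r0t; have /andP[r0 rt] := r0t.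
  have := exp_conv_le w0 g0 rt; rewrite [X in (_ <= X)%E]Ig => Yle.
  have Y0 := exp_conv_ge0 w g0 r; have := H r r0t.
  move: Yle Y0; case: exp_conv => //= y; rewrite !lee_fin => yN y0 Hr.
  apply: le_trans (_ : (gain * y `^ p^-1) `^ q <= _).
    by apply: ge0_ler_powR; rewrite ?nnegrE ?(ltW q0)// mulr_ge0 ?powR_ge0// ltW.
  rewrite powRM ?powR_ge0 ?(ltW gain_gt0)// -mulrA ler_wpM2l ?powR_ge0//.
  rewrite -powRrM [_^-1 * _]mulrC -mulr_powRB1 ?divr_gt0// [y * _]mulrC.
  apply: ler_wpM2r => //.
  by apply: ge0_ler_powR; rewrite ?nnegrE ?powR_ge0.
rewrite ge0_integralZl_EFin//; last 2 first.
- by move=> r _; exact: exp_conv_ge0.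
- exact: measurable_exp_conv.
apply: le_trans (lee_wpmul2l _ (integral_exp_conv_le t w0 g0 mg)) _.
  by rewrite lee_fin.
rewrite [X in (_ * (_ * X) <= _)%E]Ig -!EFinM lee_fin.
rewrite le_eqVlt; apply/orP; left; apply/eqP.
rewrite powRM ?(ltW gain_gt0)//.
have -> : S `^ q = S `^ p * Nq.
  rewrite /Nq mulr_powRB1 ?powR_ge0 ?divr_gt0// -powRrM mulrC divfK//.
  by rewrite gt_eqF.
by ring.
Qed.

Lemma integral_semigroup_powR q t x : 1 <= q ->
  (\int[mu]_(r in `[0%R, t]) (`|T r x| `^ q)%:E <=
   (w^-1 * (M * `|x|) `^ q)%:E)%E.
Proof.
move=> q1; have q0 : 0 < q by rewrite (lt_le_trans _ q1).
have Mx : 0 <= M * `|x| by rewrite mulr_ge0// ltW.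
have me : measurable_fun (`[0, t]%classic : set MR)
    (fun r => (expR (- w * (r - 0)))%:E).
  apply/measurable_EFinP; apply: measurableT_comp => //.
  by apply: measurable_funM => //; apply: measurable_funB.
apply: (@le_trans _ _ (\int[mu]_(r in `[0%R, t])
    (((M * `|x|) `^ q)%:E * (expR (- w * (r - 0)))%:E))%E).
  apply: ge0_le_integralW => r; first by rewrite lee_fin powR_ge0.
  rewrite /= in_itv/= subr0 => /andP[r0 rt]; rewrite -EFinM lee_fin.
  apply: (@le_trans _ _ ((M * `|x| * expR (- w * r)) `^ q)).
    apply: ge0_ler_powR; rewrite ?nnegrE ?(ltW q0) ?mulr_ge0 ?expR_ge0 ?(ltW M0)//.
    by rewrite mulrAC; exact: Tw.
  rewrite powRM ?expR_ge0// ler_wpM2l ?powR_ge0//.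
  (* The exponential is at most 1 and q >= 1, so its q-th power is at most itself and the constant
     1/w serves again. *)
  apply: ge1r_powR => //; rewrite expR_gt0/= expR_le1 mulNr oppr_le0.
  by rewrite mulr_ge0// ltW.
rewrite ge0_integralZl_EFin//; last by rewrite powR_ge0.
rewrite [w^-1 * _]mulrC [X in (_ <= X)%E]EFinM.
apply: lee_wpmul2l; first by rewrite lee_fin powR_ge0.
exact: integral_expR_decay_le.
Qed.

End stable_estimates.

(** * Input-to-state stability *)

Section comparison_function_examples.
Context (R : realType).

Lemma class_Kinf_linear (c : R) : 0 < c -> class_Kinf (fun r => c * r).
Proof.
move=> c0; split; last first.
  move=> m; exists (`|m| / c + 1); first by rewrite addr_ge0// divr_ge0// ltW.
  rewrite mulrDr mulr1 mulrCA mulfV ?gt_eqF// mulr1.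
  by apply: le_lt_trans (ler_norm m) _; rewrite ltrDl.
split.
- by apply: continuous_subspaceT => r; apply: cvgMl_tmp; exact: cvg_id.
- by move=> r r0; rewrite mulr_ge0// ltW.
- by move=> r s _ rs; rewrite ltr_pM2l.
- by rewrite mulr0.
Qed.

Lemma class_KL_exp (M w : R) : 0 < M -> 0 < w ->
  class_KL (fun r t => M * expR (- w * t) * r).
Proof.
move=> M0 w0.
have ce : continuous (fun t : R => expR (- w * t)).
  move=> t; apply: continuous_comp; last exact: continuous_expR.
  by apply: cvgMl_tmp; exact: cvg_id.
split.
- apply: continuous_subspaceT => z; apply: (@cvgM _ (R * R)%type).
    apply: cvgMl_tmp; apply: (cvg_comp (fun z : R * R => z.2)
      (fun t : R => expR (- w * t))); [exact: cvg_snd|exact: ce].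
  exact: cvg_fst.
- move=> t t0; have M0e : 0 < M * expR (- w * t) by rewrite mulr_gt0 ?expR_gt0.
  by case: (class_Kinf_linear M0e).
- move=> r r0; split.
  + apply: continuous_subspaceT => t; apply: cvgMr_tmp; apply: cvgMl_tmp.
    exact: ce.
  + by move=> t t0; rewrite !mulr_ge0 ?expR_ge0 ?ltW.
  + move=> s t s0 st; rewrite ltr_pM2r// ltr_pM2l// ltr_expR.
    by rewrite !mulNr ltrN2 ltr_pM2l.
  + rewrite -[X in _ --> X](mul0r r) -[X in X * r](mulr0 M).
    apply: cvgMr_tmp; apply: cvgMl_tmp.
    rewrite (_ : (fun _ => _) = (fun z => expR (- z)) \o (fun t => w * t)).
      apply: cvg_comp; last exact: cvgr_expR.
      exact: gt0_cvgMry.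
    by apply/funext => t /=; rewrite mulNr.
Qed.

End comparison_function_examples.

Section zero_input.
Context (R : realType) (X U : completeNormedModType R).
Context (T : R -> X -> X) (B : {linear U -> X}).
Hypothesis hT : C0_semigroup T.

Lemma eLp_norm_cst0 (p t : R) : p != 0 -> eLp_norm p t (fun=> 0 : U) = 0%E.
Proof.
move=> p0; rewrite eLp_normE// integral0_eq ?poweR0r ?invr_eq0//.
by move=> r _; rewrite normr0 powR0.
Qed.

Lemma mem_Lp_cst0 (p t : R) : p != 0 -> mem_Lp p t (fun=> 0 : U).
Proof.
move=> p0; split; last by rewrite eLp_norm_cst0.
exact/strongly_measurable_simple_limit/simple_limit_simple/simple_fun_cst.
Qed.

Lemma mild_solution_cst0 t x : mild_solution T B t x (fun=> 0) = T t x.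
Proof.
rewrite /mild_solution (_ : input_map _ _ _ _ = 0) ?addr0//.
apply/eqP; rewrite -normr_le0 -lee_fin.
apply: le_trans (norm_Bochner_integral _ _) _.
rewrite integral0_eq// => r; rewrite /= in_itv/= => /andP[r0 rt].
by rewrite /convolution_integrand linear0 (sg_at0 hT) ?normr0 ?subr_ge0.
Qed.

Lemma ISS_exponentially_stable p : 1 <= p -> Lp_ISS T B p ->
  exponentially_stable T.
Proof.
move=> p1 [_ [beta [g [[_ bK bL] [[_ _ _ g0] _] H]]]].
have p0 : p != 0 by rewrite gt_eqF// (lt_le_trans _ p1).
have [_ _ _ /cvgrPdist_le/(_ 2^-1)] := bL 1 ltr01.
rewrite invr_gt0 ltr0n => /(_ isT) [N [_ HN]].
(* The threshold [N] of the limit can be negative; |N| + 1 is a positive time beyond it. *)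
have tN : N < `|N| + 1 by apply: le_lt_trans (ler_norm N) _; rewrite ltrDl.
have t0 : 0 < `|N| + 1 by rewrite ltr_wpDl.
apply: (contraction_exponentially_stable hT t0) => x x1.
have := H _ x _ (ltW t0) (mem_Lp_cst0 _ p0).
rewrite mild_solution_cst0 /Lp_norm eLp_norm_cst0// g0 addr0 => /le_trans; apply.
have := HN _ tN; rewrite sub0r normrN; apply: le_trans.
apply: le_trans (ler_norm _).
have [_ _ bmono _] := bK _ (ltW t0).
have [->//|xn1] := eqVneq `|x| 1.
by apply/ltW/bmono => //; rewrite lt_neqAle xn1.
Qed.

End zero_input.

Section eLp_norm_bounds.
Context (R : realType) (E : normedModType R).
Local Notation mu := (@lebesgue_measure R).

Lemma eLp_norm_leP (q t z : R) (f : R -> E) : 0 < q -> 0 <= z ->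
  (eLp_norm q t f <= z%:E)%E <->
  (\int[mu]_(r in `[0%R, t]) (`|f r| `^ q)%:E <= (z `^ q)%:E)%E.
Proof.
move=> q0 z0; rewrite eLp_normE ?gt_eqF//; set I := integral _ _ _.
have I0 : (0 <= I)%E by apply: integral_ge0 => r _; rewrite lee_fin powR_ge0.
have qi : 0 < q^-1 by rewrite invr_gt0.
case: I I0 => [y| |]//; last by rewrite poweRyr ?gt_eqF.
rewrite poweR_EFin !lee_fin => y0; split => [yz|yz].
  rewrite -[y]powRr1// -[1](mulVf (_ : q != 0)) ?gt_eqF// powRrM.
  by apply: ge0_ler_powR; rewrite ?nnegrE ?powR_ge0 ?(ltW q0).
rewrite -[leRHS]powRr1// -[X in _ <= _ `^ X](mulfV (_ : q != 0)) ?gt_eqF// powRrM.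
by apply: ge0_ler_powR; rewrite ?nnegrE ?powR_ge0 ?(ltW qi).
Qed.

(** A substitute for Minkowski's inequality; the factor 2^q is absorbed into the gains. *)
Lemma integral_powRD (q t : R) (f g : R -> E) : 0 <= q ->
  strongly_measurable t f -> strongly_measurable t g ->
  (\int[mu]_(r in `[0%R, t]) (`|f r + g r| `^ q)%:E <=
   (2 `^ q)%:E * (\int[mu]_(r in `[0%R, t]) (`|f r| `^ q)%:E +
                  \int[mu]_(r in `[0%R, t]) (`|g r| `^ q)%:E))%E.
Proof.
move=> q0 /strongly_measurableP[f' lf' ff'] /strongly_measurableP[g' lg' gg'].
rewrite (integral_powR_repr q ff') (integral_powR_repr q gg').
rewrite (@integral_powR_repr _ _ q t (f \+ g) (f' \+ g')); last first.
  by apply: filterS2 ff' gg' => r ff' gg' rt /=; rewrite ff'// gg'.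
have mp h : simple_limit h ->
    measurable_fun (`[0, t]%classic : set (measurableTypeR R))
      (fun r => (`|h r : E| `^ q)%:E).
  by move=> lh; apply/measurable_EFinP/measurable_funTS; exact: measurable_norm_powR.
rewrite -ge0_integralD//; try exact: mp.
rewrite -ge0_integralZl_EFin//.
- apply: ge0_le_integralW => r _; rewrite ?lee_fin ?powR_ge0//.
  apply: le_trans (powRD_le _ _ q0) => //.
  by apply: ge0_ler_powR; rewrite ?nnegrE// ?addr_ge0//; exact: ler_normD.
- by move=> r _; rewrite adde_ge0// lee_fin powR_ge0.
- by apply: emeasurable_funD; exact: mp.
Qed.

End eLp_norm_bounds.

Section implications.
Context (R : realType) (X U : completeNormedModType R).
Context (T : R -> X -> X) (B : {linear U -> X}).
Hypotheses (hT : C0_semigroup T) (hB : continuous B).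
Local Notation mu := (@lebesgue_measure R).
Local Notation MR := (measurableTypeR R).

Let bounded_B : exists2 b, 0 < b & forall y, `|B y| <= b * `|y|.
Proof. exact: (continuous_linear_le_norm (@linearP _ _ _ _ B) hB). Qed.

Lemma exponentially_stable_ISS p : 1 <= p -> exponentially_stable T ->
  Lp_ISS T B p.
Proof.
move=> p1 /(exponentially_stableP hT)[M [w [M0 w0 Tw]]].
have [b b0 Bb] := bounded_B.
split.
  by exists 1 => // u /(mem_Lp_L1 p1); exact: convolution_integrable b0 Bb _ _.
exists (fun r t => M * expR (- w * t) * r), (fun r => b * M * (w^-1 + 1) * r); split.
- exact: class_KL_exp.
- by apply: class_Kinf_linear; rewrite !mulr_gt0// addr_gt0// invr_gt0.
move=> t x u t0 Lu; apply: le_trans (ler_normD _ _) _.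
by apply: lerD; [exact: Tw|exact: norm_input_map_Lp].
Qed.

Lemma exponentially_stable_Lp_Lq_ISS p q : 1 <= p -> p <= q ->
  exponentially_stable T -> Lp_Lq_ISS T B p q.
Proof.
move=> p1 pq /(exponentially_stableP hT)[M [w [M0 w0 Tw]]].
have [b b0 Bb] := bounded_B.
have q1 : 1 <= q := le_trans p1 pq; have q0 : 0 < q by rewrite (lt_le_trans _ q1).
pose gain := b * M * (w^-1 + 1).
have gain0 : 0 < gain by rewrite !mulr_gt0// addr_gt0// invr_gt0.
have Phi_meas t u : mem_Lp p t u -> strongly_measurable t (input_map T B ^~ u).
  by move=> /(mem_Lp_L1 p1); exact: input_map_strongly_measurable b0 Bb _ _.
have IPhi t u := @integral_input_map_powR _ _ _ _ _ _ _ _ b0 Bb M0 w0 Tw p q t u p1 pq.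
split.
  exists 1 => // u Lu; split.
    move=> tau /andP[_ tau1]; apply: (convolution_integrable hT hB b0 Bb).
    exact: mem_L1S tau1 (mem_Lp_L1 p1 Lu).
  split; first exact: Phi_meas.
  by rewrite eLp_normE ?gt_eqF// poweR_lty// (le_lt_trans (IPhi _ _ Lu))// ltry.
(* C^q collects the factor 2^q of [integral_powRD] and one 1/w each for the semigroup and the input
   map, whose powers are both bounded by the power of the sum. *)
pose C := (2 `^ q * (w^-1 + w^-1)) `^ q^-1.
have C0 : 0 < C.
  by rewrite powR_gt0// mulr_gt0 ?powR_gt0// addr_gt0// invr_gt0.
exists (fun r => C * M * r), (fun r => C * gain * r); split.
- by apply: class_Kinf_linear; rewrite mulr_gt0.
- by apply: class_Kinf_linear; rewrite mulr_gt0.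
move=> t x u t0 Lu; set S := Lp_norm p t u; have S0 : 0 <= S by exact: Lp_norm_ge0.
have Mx0 : 0 <= M * `|x| by rewrite mulr_ge0// ltW.
have gS0 : 0 <= gain * S by rewrite mulr_ge0// ltW.
have -> : C * M * `|x| + C * gain * S = C * (M * `|x| + gain * S) by ring.
apply/eLp_norm_leP => //.
  by rewrite mulr_ge0 ?addr_ge0// ltW.
have T_meas : strongly_measurable t (T ^~ x).
  apply: right_continuous_strongly_measurable => r /andP[r0 _].
  exact: (sg_right_continuous hT).
apply: le_trans (integral_powRD (ltW q0) T_meas (Phi_meas _ _ Lu)) _.
apply: (@le_trans _ _ ((2 `^ q)%:E * ((w^-1 * (M * `|x|) `^ q)%:E +
    (w^-1 * (gain * S) `^ q)%:E))%E).
  apply: lee_wpmul2l; first by rewrite lee_fin powR_ge0.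
  by apply: leeD; [exact: integral_semigroup_powR|exact: IPhi].
rewrite -EFinD -EFinM lee_fin [leRHS]powRM ?addr_ge0 ?(ltW C0)//.
rewrite /C -powRrM mulVf ?gt_eqF// powRr1; last first.
  by rewrite mulr_ge0 ?powR_ge0// addr_ge0// invr_ge0 ltW.
rewrite -mulrA ler_wpM2l ?powR_ge0// mulrDl; apply: lerD.
  rewrite ler_wpM2l ?invr_ge0 ?(ltW w0)//. apply: ge0_ler_powR;
    by rewrite ?nnegrE ?addr_ge0 ?(ltW q0)// lerDl.
rewrite ler_wpM2l ?invr_ge0 ?(ltW w0)//; apply: ge0_ler_powR;
  by rewrite ?nnegrE ?addr_ge0 ?(ltW q0)// lerDr.
Qed.

(* Datko's theorem, in the uniform form provided by the ISS estimate: the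
   integrals bound [`|T t x|] uniformly in [t], and then [t * `|T t x| `^ q]. *)
Lemma Lp_Lq_ISS_exponentially_stable p q : 1 <= p -> p <= q ->
  Lp_Lq_ISS T B p q -> exponentially_stable T.
Proof.
move=> p1 pq [_ [s [g [[[_ s0 smono _] _] [[_ _ _ g0] _] H]]]].
have q0 : 0 < q by rewrite (lt_le_trans _ pq)// (lt_le_trans _ p1).
have p0 : p != 0 by rewrite gt_eqF// (lt_le_trans _ p1).
pose c := s 1; have c0 : 0 <= c by exact: s0.
have intT t x : 0 <= t -> `|x| <= 1 ->
    (\int[mu]_(r in `[0%R, t]) (`|T r x| `^ q)%:E <= (c `^ q)%:E)%E.
  move=> t0 x1; apply/eLp_norm_leP => //.
  have := H t x _ t0 (mem_Lp_cst0 U t p0).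
  rewrite /Lp_norm eLp_norm_cst0// g0 addr0.
  rewrite (_ : (fun r => mild_solution T B r x (fun=> 0)) = T ^~ x); last first.
    by apply/funext => r; rewrite mild_solution_cst0.
  move=> /le_trans; apply; rewrite lee_fin.
  have [->//|xn1] := eqVneq `|x| 1.
  by apply/ltW/smono => //; rewrite lt_neqAle xn1.
(* If up to the factor L the orbit dominates its final value on all of [a, t], then the integral of
   its q-th power is at least (t - a) (|T(t)x| / L)^q. It is used on a window of length 1 for
   boundedness and on [0, tau] for decay. *)
have avg (a t : R) x (L : R) : 0 <= a <= t -> 0 < L -> `|x| <= 1 ->
    (forall r, a <= r <= t -> `|T t x| <= L * `|T r x|) ->
    (t - a) * (`|T t x| / L) `^ q <= c `^ q.
  move=> /andP[a0 at_] L0 x1 HL; rewrite -lee_fin mulrC.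
  have t0 : 0 <= t := le_trans a0 at_.
  apply: le_trans (intT t x t0 x1).
  apply: (@le_trans _ _ (\int[mu]_(r in `[a, t]) (`|T r x| `^ q)%:E)%E); last first.
    apply: ge0_subset_integralW => [r|r]; last by rewrite lee_fin powR_ge0.
    by rewrite /= !in_itv/= => /andP[ar ->]; rewrite (le_trans a0).
  apply: (@le_trans _ _ (\int[mu]_(r in `[a, t]) ((`|T t x| / L) `^ q)%:E)%E).
    rewrite integral_cst//= lebesgue_measure_itv/= lte_fin.
    case: ltP => [_|ta]; first by rewrite -EFinB -EFinM.
    by rewrite mule0 lee_fin mulr_ge0_le0 ?powR_ge0// subr_le0.
  apply: ge0_le_integralW => r; first by rewrite lee_fin powR_ge0.
  rewrite /= in_itv/= => art; rewrite lee_fin.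
  apply: ge0_ler_powR; rewrite ?nnegrE ?(ltW q0) ?divr_ge0 ?(ltW L0)//.
  by rewrite ler_pdivrMr// mulrC; exact: HL.
have [K K1 HK] := sg_bounded hT 1.
have K0 : 0 < K by rewrite (lt_le_trans _ K1).
(* [K] bounds the orbit up to time 1, and K c bounds it afterwards by averaging over [t - 1, t]. *)
pose L := K * (1 + c); have L0 : 0 < L by rewrite mulr_gt0// ltr_wpDr.
have bT t x : 0 <= t -> `|x| <= 1 -> `|T t x| <= L.
  move=> t0 x1; have [t1|t1] := leP t 1.
    apply: le_trans (HK _ _ _) _; first by rewrite t0.
    by rewrite /L ler_wpM2l ?(ltW K0)// (le_trans x1)// lerDl.
  have HKt r : t - 1 <= r <= t -> `|T t x| <= K * `|T r x|.
    move=> /andP[tr rt]; have r0 : 0 <= r by apply: le_trans tr; rewrite subr_ge0 ltW.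
    rewrite -[in T t](subrK r t) sgD ?subr_ge0//; apply: HK.
    by rewrite subr_ge0 rt/= lerBlDl -lerBlDr.
  have := avg (t - 1) t x K; rewrite subr_ge0 (ltW t1) gerBl ler01 => /(_ isT K0 x1).
  rewrite subKr mul1r => h; have {}h := h (fun r art => HKt r art).
  have : `|T t x| / K <= c.
    rewrite leNgt; apply/negP => lt; move: h; apply/negP; rewrite -ltNge.
    by apply: gt0_ltr_powR; rewrite ?nnegrE// divr_ge0// ltW.
  rewrite ler_pdivrMr// => /le_trans; apply.
  by rewrite /L mulrC ler_wpM2l ?(ltW K0)// lerDr.
(* Chosen so that tau (1 / (2 L))^q > c^q: a value of |T(tau)x| above 1/2 would violate the
   averaging bound on [0, tau]. *)
pose tau := c `^ q * (2 * L) `^ q + 1.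
have tau0 : 0 < tau by rewrite ltr_wpDl// mulr_ge0// powR_ge0.
apply: (contraction_exponentially_stable hT tau0) => x x1.
rewrite leNgt; apply/negP => lt.
have HLt r : 0 <= r <= tau -> `|T tau x| <= L * `|T r x|.
  move=> /andP[r0 rt]; rewrite -[in T tau](subrK r tau) (sgD hT) ?subr_ge0//.
  apply: (linear_le_norm (sg_linear hT _)); rewrite ?subr_ge0//.
  by move=> y y1; apply: bT => //; rewrite subr_ge0.
have := avg 0 tau x L; rewrite lexx (ltW tau0) subr0 => /(_ isT L0 x1 HLt).
apply/negP; rewrite -ltNge.
have L20 : 0 < (2 * L) `^ q by rewrite powR_gt0// mulr_gt0.
apply: (@lt_le_trans _ _ (tau * (2 * L)^-1 `^ q)); last first.
  rewrite ler_wpM2l ?(ltW tau0)//; apply: ge0_ler_powR; rewrite ?nnegrE.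
  - exact: ltW.
  - by rewrite invr_ge0 mulr_ge0// ltW.
  - by rewrite divr_ge0// ltW.
  - by rewrite invfM ler_wpM2r ?invr_ge0 ?(ltW L0)// ltW.
have L2 : 0 <= 2 * L by rewrite mulr_ge0 ?(ltW L0).
rewrite -powR_inv1// -powRrM mulN1r powRN.
by rewrite ltr_pdivlMr// /tau ltrDl.
Qed.

End implications.

(** * The Lyapunov functional *)

Section Lyapunov.
Context (R : realType) (X U : completeNormedModType R).
Context (T : R -> X -> X) (B : {linear U -> X}).
Hypotheses (hT : C0_semigroup T) (hB : continuous B).
Local Notation mu := (@lebesgue_measure R).
Local Notation V l := (fun x => fine (sup_functional T l x)).

Lemma sup_functional_ub l t x : 0 <= t ->
  ((expR (l * t) * `|T t x|)%:E <= sup_functional T l x)%E.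
Proof.
by move=> t0; apply: ereal_sup_ubound; exists t => //=; rewrite in_itv/= t0.
Qed.

Lemma sup_functional_le l x c :
  (forall t, 0 <= t -> expR (l * t) * `|T t x| <= c) ->
  (sup_functional T l x <= c%:E)%E.
Proof.
move=> H; apply: ge_ereal_sup => _ [t /= t0 <-]; rewrite lee_fin; apply: H.
by move: t0; rewrite in_itv/= andbT.
Qed.

(** On the unit ball e^(l t) |T(t)y| <= V(y) <= psi2(1). Linearity of T(t) extends the bound to all
    vectors although [psi2] is not linear, so psi2(1) becomes the constant M. *)
Lemma Lyapunov_exponentially_stable l : 0 < l ->
  (forall x, sup_functional T l x \is a fin_num) ->
  coercive_L1_ISS_Lyapunov T B (V l) -> exponentially_stable T.
Proof.
move=> l0 fV [_ _ [psi1 [psi2 [a3 [a4 [[_ [psi2K _]] _ Vb _]]]]]].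
have [_ _ psi2mono psi20] := psi2K.
have psi21 : 0 < psi2 1 by rewrite -psi20; exact: psi2mono.
apply/(exponentially_stableP hT); exists (psi2 1), l; split => // t x t0.
apply: (linear_le_norm (sg_linear hT t0)) => y y1.
rewrite mulNr expRN ler_pdivlMr ?expR_gt0// mulrC -lee_fin.
apply: le_trans (sup_functional_ub l y t0) _.
rewrite -(fineK (fV y)) lee_fin; have /andP[_ /le_trans] := Vb y; apply.
have [->//|yn1] := eqVneq `|y| 1.
by apply/ltW/psi2mono => //; rewrite lt_neqAle yn1.
Qed.

Section exponentially_stable_Lyapunov.
Context (M w : R).
Hypotheses (M0 : 0 < M) (w0 : 0 < w).
Hypothesis Tw : forall t x, 0 <= t -> `|T t x| <= M * expR (- w * t) * `|x|.

Let sup_functional_leM x : (sup_functional T w x <= (M * `|x|)%:E)%E.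
Proof.
apply: sup_functional_le => t t0.
apply: (@le_trans _ _ (expR (w * t) * (M * expR (- w * t) * `|x|))).
  by apply: ler_wpM2l; [exact: expR_ge0|exact: Tw].
by rewrite mulNr expRN mulrA mulrCA mulfV ?gt_eqF ?expR_gt0// mulr1.
Qed.

Let sup_functional_fin x : sup_functional T w x \is a fin_num.
Proof.
rewrite ge0_fin_numE ?(le_lt_trans (sup_functional_leM x)) ?ltry//.
apply: le_trans (sup_functional_ub w x (lexx 0)).
by rewrite lee_fin mulr_ge0 ?expR_ge0.
Qed.

Let V_ub t x : 0 <= t -> expR (w * t) * `|T t x| <= V w x.
Proof. by move=> t0; rewrite -lee_fin fineK//; exact: sup_functional_ub. Qed.

Let V_le x c : (forall t, 0 <= t -> expR (w * t) * `|T t x| <= c) -> V w x <= c.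
Proof. by move=> H; rewrite -lee_fin fineK//; exact: sup_functional_le. Qed.

Let V_leM x : V w x <= M * `|x|.
Proof. by rewrite -lee_fin fineK. Qed.

Let V_ge x : `|x| <= V w x.
Proof.
by apply: le_trans (V_ub x (lexx 0)); rewrite mulr0 expR0 mul1r (sg0 hT).
Qed.

Let V_add x y : V w (x + y) <= V w x + V w y.
Proof.
apply: V_le => t t0; rewrite (sg_add hT)//.
apply: (@le_trans _ _ (expR (w * t) * (`|T t x| + `|T t y|))).
  by rewrite ler_wpM2l ?expR_ge0//; exact: ler_normD.
by rewrite mulrDr lerD//; exact: V_ub.
Qed.

Let V_decay h x : 0 <= h -> V w (T h x) <= expR (- w * h) * V w x.
Proof.
move=> h0; apply: V_le => t t0; rewrite -(sgD hT)//.
rewrite mulNr expRN ler_pdivlMl ?expR_gt0// mulrA -expRD -mulrDr addrC.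
by apply: V_ub; rewrite addr_ge0.
Qed.

(** Subadditivity together with V <= M |.| makes V Lipschitz with constant M. *)
Let V_continuous : continuous (V w).
Proof.
move=> x; apply/cvgrPdist_le => e e0; have eM : 0 < e / M by rewrite divr_gt0.
have VB y z : V w y - V w z <= M * `|y - z|.
  rewrite lerBlDr -[in V w y](subrK z y); apply: le_trans (V_add _ _) _.
  by rewrite lerD2r; exact: V_leM.
have /cvgrPdist_le/(_ _ eM) : y @[y --> x] --> x by exact: cvg_id.
apply: filterS => y xy; rewrite ler_norml lerNl opprB.
have xyM : M * `|x - y| <= e by rewrite mulrC -ler_pdivlMr.
by rewrite (le_trans (VB _ _))//= ?(le_trans (VB _ _))// distrC.
Qed.

(** The input map is of first order in t; after division by t this bound yields the input term of
    the Lie derivative. *)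
Lemma norm_input_map_sup b c t u : 0 <= b -> 0 <= c ->
  (forall y, `|B y| <= b * `|y|) -> 0 <= t ->
  (forall s, 0 <= s <= t -> `|u s| <= c) ->
  `|input_map T B t u| <= b * M * c * t.
Proof.
move=> b0 c0 Bb t0 uc; rewrite -lee_fin.
apply: le_trans (@norm_input_map _ _ _ T B b Bb (cst M) t u _ _) _.
- by move=> a; exact: ltW.
- move=> a x /andP[a0 _]; apply: le_trans (Tw x a0) _.
  rewrite ler_wpM2r// ler_piMr ?(ltW M0)// expR_le1 mulNr oppr_le0.
  by rewrite mulr_ge0// ltW.
apply: (@le_trans _ _ (\int[mu]_(s in `[0%R, t]) (b * M * c)%:E)%E).
  apply: ge0_le_integralW => s; first by rewrite lee_fin !mulr_ge0// ltW.
  rewrite /= in_itv/= => st; rewrite lee_fin ler_wpM2l ?uc//.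
  by rewrite mulr_ge0// ltW.
rewrite integral_cst//= lebesgue_measure_itv/= lte_fin.
case: ltP => [_|_]; first by rewrite sube0 -EFinM.
by rewrite mule0 lee_fin !mulr_ge0// ltW.
Qed.

(** Half of the derivative -w at 0 is given up for an inequality on a whole interval of times; hence
    a3 = w/2. *)
Let expR_quotient_le t : 0 < t -> w * t <= 1 ->
  t^-1 * (expR (- w * t) - 1) <= - (w / 2).
Proof.
move=> t0 wt; rewrite ler_pdivrMl// lerBlDr mulNr expRN.
have wt0 : 0 < w * t by rewrite mulr_gt0.
rewrite -[leLHS]mul1r ler_pdivrMr ?expR_gt0//.
(* With x = w t, e^x >= 1 + x reduces the claim to (1 - x/2)(1 + x) = 1 + x (1 - x)/2 >= 1. *)
apply: (@le_trans _ _ ((t * - (w / 2) + 1) * (1 + w * t))); last first.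
  rewrite ler_wpM2l ?expR_ge1Dx//.
  have -> : t * - (w / 2) + 1 = 1 - (w * t) / 2 by field.
  by rewrite subr_ge0; lra.
have -> : (t * - (w / 2) + 1) * (1 + w * t) =
  1 + (w * t) * (1 - w * t) / 2 by field.
by rewrite lerDl divr_ge0// mulr_ge0 ?subr_ge0// ltW.
Qed.

Lemma sup_functional_Lyapunov :
  (forall x, sup_functional T w x \is a fin_num) /\
  coercive_L1_ISS_Lyapunov T B (V w).
Proof.
have [b b0 Bb] : exists2 b, 0 < b & forall y, `|B y| <= b * `|y|.
  exact: (continuous_linear_le_norm (@linearP _ _ _ _ B) hB).
split=> //; split=> //.
  by move=> x; apply: le_trans (V_ge x).
(* One [M] comes from V <= M |.|, and b M from the bound on the input map. *)
pose k := M * (b * M); have k0 : 0 < k by rewrite !mulr_gt0.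
exists (fun r => 1 * r), (fun r => M * r), (w / 2), k; split.
- by split; exact: class_Kinf_linear.
- by rewrite divr_gt0.
- by move=> x; rewrite mul1r V_ge V_leM.
move=> x u /continuous_within_itvcyP[_ cu].
apply/lee_addgt0Pr => e e0; have ek : 0 < e / k by rewrite divr_gt0.
have /cvgrPdist_le/(_ _ ek) [d /= d0 Hd] := cu.
(* The upper limit is an infimum over neighbourhoods, so one right neighbourhood suffices: there u
   stays within e/k of u(0), which costs e after multiplication by [k]. *)
pose A : set R := [set t | [/\ 0 < t, t < d & w * t <= 1]].
have nA : (0:R)^'+ A.
  near=> t; split.
  - by near: t; exact: nbhs_right_gt.
  - by near: t; exact: nbhs_right_lt.
  - rewrite mulrC -ler_pdivlMr// mul1r.
    by near: t; apply: nbhs_right_le; rewrite invr_gt0.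
apply: le_trans (ereal_inf_lbound _) _; first by exists A.
apply: ge_ereal_sup => _ [t [t0 td wt] <-]; rewrite -EFinD lee_fin.
have t0' := ltW t0.
have uc s : 0 <= s <= t -> `|u s| <= `|u 0| + e / k.
  move=> /andP[]; rewrite le_eqVlt => /predU1P[<- _|s0 st].
    by rewrite lerDl ltW.
  have := Hd s; rewrite /= sub0r normrN gtr0_norm// (le_lt_trans st)// => /(_ isT s0).
  move=> h; rewrite -[u s](subrK (u 0)) addrC (le_trans (ler_normD _ _))//.
  by rewrite lerD2l distrC.
have c0 : 0 <= `|u 0| + e / k by rewrite addr_ge0// ltW.
have HPhi := norm_input_map_sup (ltW b0) c0 Bb t0' uc.
have : V w (mild_solution T B t x u) - V w x <=
    (expR (- w * t) - 1) * V w x + k * (`|u 0| + e / k) * t.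
  rewrite lerBlDr mulrBl mul1r addrAC subrK; apply: le_trans (V_add _ _) _.
  apply: lerD; first exact: V_decay.
  apply: le_trans (V_leM _) _; rewrite /k -2!mulrA ler_wpM2l ?(ltW M0)//.
  by rewrite mulrA.
move/(ler_wpM2l (_ : 0 <= t^-1)) => /(_ _)/le_trans; apply; first by rewrite invr_ge0.
rewrite mulrDr mulrA -addrA; apply: lerD.
  rewrite ler_wpM2r//; last exact: expR_quotient_le.
  by apply: le_trans (V_ge x).
rewrite mulrCA mulVf ?gt_eqF// mulr1 mulrDr mulrCA mulfV ?gt_eqF// mulr1.
exact: lexx.
Unshelve. all: by end_near. Qed.

End exponentially_stable_Lyapunov.

(** Finiteness is part of the conclusion because [fine] sends an infinite supremum to 0; it
    guarantees that V is the actual supremum. *)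
Lemma exponentially_stable_Lyapunov : exponentially_stable T ->
  exists l : R, [/\ 0 < l,
    forall x, sup_functional T l x \is a fin_num &
    coercive_L1_ISS_Lyapunov T B (V l)].
Proof.
move=> /(exponentially_stableP hT)[M [w [M0 w0 Tw]]]; exists w.
by have [] := sup_functional_Lyapunov M0 w0 Tw.
Qed.

End Lyapunov.

Theorem theorem4p3 (R : realType) (X U : completeNormedModType R)
    (A : X -> X) (DA : set X) (T : R -> X -> X) (B : {linear U -> X})
    (hT : C0_semigroup T) (hA : generates A DA T) (hB : continuous B) :
  [<-> exists p : R, 1 <= p /\ Lp_ISS T B p;
       forall p : R, 1 <= p -> Lp_ISS T B p;
       exponentially_stable T;
       exists l : R, [/\ 0 < l,
         forall x, sup_functional T l x \is a fin_num &
         coercive_L1_ISS_Lyapunov T B (fun x => fine (sup_functional T l x))];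
       exists p q : R, [/\ 1 <= p, p <= q & Lp_Lq_ISS T B p q];
       forall p q : R, 1 <= p -> p <= q -> Lp_Lq_ISS T B p q].
Proof.
have ISS_stable p := @ISS_exponentially_stable _ _ _ _ B hT p.
have stable_ISS p := @exponentially_stable_ISS _ _ _ _ B hT hB p.
have LpLq_stable p q := @Lp_Lq_ISS_exponentially_stable _ _ _ _ B hT p q.
have stable_LpLq p q := @exponentially_stable_Lp_Lq_ISS _ _ _ _ B hT hB p q.
have one1 : (1 : R) <= 1 by [].
(* Passing from some exponents to all of them goes through exponential stability, which involves no
   exponent. *)
tfae.
- by move=> [p [p1 /(ISS_stable _ p1) st]] q q1; exact: stable_ISS.
- by move=> /(_ 1 one1)/(ISS_stable _ one1).
- exact: exponentially_stable_Lyapunov.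
- move=> [l [l0 fV /(Lyapunov_exponentially_stable hT l0 fV) st]].
  by exists 1, 1; split => //; exact: stable_LpLq.
- move=> [p [q [p1 pq /(LpLq_stable _ _ p1 pq) st]]] p' q' p'1 p'q'.
  exact: stable_LpLq.
- move=> /(_ 1 1 one1 one1)/(LpLq_stable _ _ one1 one1) st.
  by exists 1; split => //; exact: stable_ISS.
Qed.
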